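(* Let $K$ be a field of characteristic $0$, let $P=K[x_1,\dots,x_n]$ with $n\ge 2$, and let $I\subseteq P$ be a homogeneous ideal. If there exists $\delta\in\mathbb{N}$ such that $I_\delta\ne\{0\}$ and $\mathcal{M}_{P/I}(2,\delta)=\mathcal{M}_{P/I}(2,\delta+1)$ (i.e. $\mathcal{M}_{P/I}$ has $2$-maximal growth in degree $\delta$), then $\langle I_{\le\delta}\rangle$ has a GCD of degree $\mathcal{M}_{P/I}(2,\delta)$. Furthermore, $\langle I_{\le\delta+1}\rangle$ shares the same GCD.
   Context: $P$ has the standard grading. For a homogeneous ideal $I\subseteq P$, the sectional matrix of $P/I$ is the function $\mathcal{M}_{P/I}:\{1,\dots,n\}\times\mathbb{N}\to\mathbb{N}$, $\mathcal{M}_{P/I}(i,d)=\dim_K\big(P_d/(I+(L_1,\dots,L_{n-i}))_d\big)$, where $L_1,\dots,L_{n-i}$ are generic linear forms (the value is the same for all choices of coefficients in a suitable non-empty Zariski-open set). $\mathcal{M}_{P/I}$ has $i$-maximal growth in degree $d$ if $\mathcal{M}_{P/I}(i,d+1)=\sum_{j=1}^{i}\mathcal{M}_{P/I}(j,d)$. For $\delta\in\mathbb{N}$, $\langle I_{\le\delta}\rangle$ denotes the ideal of $P$ generated by the homogeneous elements of $I$ of degree $\le\delta$. The GCD of an ideal is the greatest common divisor (up to a nonzero scalar) of all its elements; the GCD may be $1$, of degree $0$. *)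

(* Defs.v *)
From mathcomp Require Import all_boot all_algebra.
From mathcomp Require Import mpoly.
From Stdlib Require Import Classical ClassicalEpsilon.

Set Implicit Arguments.
Unset Strict Implicit.
Unset Printing Implicit Defensive.

Import GRing.Theory.
Local Open Scope ring_scope.

Section Ideals.
Context {K : fieldType} {n : nat}.
Implicit Types (f g h : {mpoly K[n]}) (S I J : {mpoly K[n]} -> Prop).

(* Ideals are Prop-valued sets, and the unit ideal is allowed; MathComp's
   [idealr] covers only proper ideals given by boolean predicates. *)
Definition is_ideal J : Prop :=
  [/\ J 0, forall f g, J f -> J g -> J (f + g) & forall f g, J g -> J (f * g)].

Definition is_homogeneous_ideal I : Prop :=
  is_ideal I /\ forall f d, I f -> I (pihomog mdeg d f).

Definition ideal_gen S : {mpoly K[n]} -> Prop := fun f =>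
  exists (k : nat) (a g : 'I_k -> {mpoly K[n]}),
    (forall i, S (g i)) /\ f = \sum_(i < k) a i * g i.

Definition truncated_ideal I (delta : nat) : {mpoly K[n]} -> Prop :=
  ideal_gen (fun f => I f /\ exists2 d, (d <= delta)%N & f \is d.-homog).

Definition mpoly_dvd g f : Prop := exists q, f = q * g.

Definition is_gcd S g : Prop :=
  (forall f, S f -> mpoly_dvd g f) /\
  (forall h, (forall f, S f -> mpoly_dvd h f) -> mpoly_dvd h g).

Definition linear_form m (c : 'M[K]_(m, n)) (k : 'I_m) : {mpoly K[n]} :=
  \sum_(j < n) c k j *: 'X_j.

Definition add_linear_forms I m (c : 'M[K]_(m, n)) : {mpoly K[n]} -> Prop :=
  ideal_gen (fun f => I f \/ exists k, f = linear_form c k).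

End Ideals.

(* Zariski-open subsets of the affine space of m x n matrices. *)
Definition zariski_open (K : fieldType) (m n : nat)
    (U : 'M[K]_(m, n) -> Prop) : Prop :=
  exists S : {mpoly K[m * n]} -> Prop,
    forall c, U c <-> exists2 F, S F & F.@[mxvec c 0] != 0.

(* The library provides the vector space structure on forms of degree d,
   [dhomog], only when the number of variables is a successor. *)
Section Sectional.
Context {K : fieldType} {n : nat}.
Implicit Types (I J : {mpoly K[n.+1]} -> Prop).

Definition is_graded_piece J d (W : {vspace dhomog n.+1 K d}) : Prop :=
  forall p : dhomog n.+1 K d, p \in W <-> J (val p).

Definition graded_piece J d : {vspace dhomog n.+1 K d} :=
  epsilon (inhabits 0%VS) (@is_graded_piece J d).

Lemma graded_pieceP J d :
  is_ideal J -> is_graded_piece J (graded_piece J d).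
Proof.
case=> J0 JD JM; apply: epsilon_spec.
have sumJ (W1 W2 : {vspace dhomog n.+1 K d}) :
    (forall p, p \in W1 -> J (val p)) -> (forall p, p \in W2 -> J (val p)) ->
    forall p, p \in (W1 + W2)%VS -> J (val p).
  by move=> h1 h2 p /memv_addP[u uW [v vW ->]]; apply: JD; [apply: h1|apply: h2].
suff: forall k (W : {vspace dhomog n.+1 K d}),
    (forall p, p \in W -> J (val p)) -> (\dim {:dhomog n.+1 K d} - \dim W <= k)%N ->
    exists W', @is_graded_piece J d W'.
  move=> /(_ (\dim {:dhomog n.+1 K d}) 0%VS); apply; last exact: leq_subr.
  by move=> p; rewrite memv0 => /eqP ->.
elim=> [|k IH] W WJ leW.
  exists W => p; split; first exact: WJ.
  move=> _; suff -> : W = fullv by rewrite memvf.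
  by apply/eqP; rewrite eqEdim subvf /= -subn_eq0 -leqn0.
case: (classic (forall p : dhomog n.+1 K d, J (val p) -> p \in W)) => [h|].
  by exists W => p; split; [apply: WJ | apply: h].
move=> /not_all_ex_not[p hp].
have [Jp pW] : J (val p) /\ p \notin W.
  by split; [apply: NNPP | apply/negP] => h; apply: hp.
apply: (IH (W + <[p]>)%VS).
  apply: sumJ => // _ /vlineP[c ->].
  by rewrite [val _]linearZ /= -mul_mpolyC; apply: JM.
have lt_W : (\dim W < \dim (W + <[p]>))%N.
  rewrite ltn_neqAle dimvS ?addvSl // andbT; apply: contra pW => eqW.
  have /eqP -> : (W == W + <[p]>)%VS.
    by rewrite eqEdim addvSl /= (eqP eqW).
  by rewrite (subvP (addvSr _ _)) ?memv_line.
have le_f := dimvS (subvf (W + <[p]>)%VS).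
by rewrite -ltnS (leq_trans _ leW) // ltn_sub2l // (leq_trans lt_W).
Qed.

(* dim_K of P_d / J_d *)
Definition quotient_dim J d : nat :=
  (\dim {:dhomog n.+1 K d} - \dim (graded_piece J d))%N.

(* The number of variables is n.+1, hence n.+1 - i generic linear forms. *)
Definition is_generic_value I i d (r : nat) : Prop :=
  exists U : 'M[K]_(n.+1 - i, n.+1) -> Prop,
    [/\ zariski_open U, exists c, U c &
        forall c, U c -> quotient_dim (add_linear_forms I c) d = r].

Definition sectional_matrix I i d : nat :=
  epsilon (inhabits 0%N) (is_generic_value I i d).

End Sectional.

(* Main.v *)
Require Import Defs.
From HB Require Import structures.
From mathcomp Require Import all_boot all_algebra.
From mathcomp Require Import mpoly.
From mathcomp Require Import zify.
From Stdlib Require Import Classical ClassicalEpsilon.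

Set Implicit Arguments.
Unset Strict Implicit.
Unset Printing Implicit Defensive.

Import GRing.Theory.
Local Open Scope ring_scope.

(** The heart of the matter is a statement about binary forms.  If a
    space [V] of univariate polynomials of degree at most [d] contains one of
    degree [d], and if [V] and ['X * V] together lie in a space of dimension
    [\dim V + 1], then [V] consists of all multiples, of degree at most [d], of
    its element of least degree ([binary_maximal_growth]).

    Let [n.+1] be the number of variables and cut by [n.+1 - 2] generic linear
    forms.  This amounts to restricting polynomials to a generic line
    [p 'X + q], the point at infinity of the line being dropped: the value of
    the sectional matrix at [(2, d)] is the codimension, among the polynomials
    of degree at most [d], of the restrictions of the forms of degree [d] of
    the ideal ([quotient_dim_restricted], [restricted_pieceP]).  Hence the
    growth hypothesis provides a polynomial [g], whose degree is the common
    value of the sectional matrix, such that the restrictions of the forms in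
    degrees [delta] and [delta.+1] are all divisible by [g], and [g] is itself
    such a restriction ([restrict_maximal_growth]).

    It remains to lift [g] to the whole space.  Let [G] be the gcd of the forms
    of degree [delta] of the ideal.  As [g] is the restriction of one of them,
    the restriction of [G] divides [g].  Conversely [g] divides the restriction
    of [G], because a generic line acquires no common divisor that the ambient
    space does not have ([restrict_gcd]): with the coordinates of [q] as
    indeterminates, the restrictions of the forms satisfy a Bezout identity
    with gcd [G] up to a nonzero factor [r] free of ['X], and this identity
    survives for every [q] that is not a root of [r].  So [G] has the degree of
    [g].  The same argument in degree [delta.+1] gives a gcd of the same
    degree; it divides [G], since it divides every ['X_i * f] with [f] of degree
    [delta], and therefore both gcds agree.  Forms of lower degree are reached
    by the same multiplication by variables ([is_gcd_truncated]).

    Two supporting theories are developed on the way.  Gcds of multivariate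
    polynomials come from Gauss's lemma, by induction on the number of
    variables.  Genericity is handled through explicit nonzero polynomials in
    the coefficients of the linear forms: the line has to be chosen so that the
    linear forms cutting it out avoid the roots of such a polynomial while [p]
    and [q] avoid the roots of others, the one for [q] depending on [p].  This is
    done by moving the line linearly, first through [p] and then through [q]
    ([line_step]).  Characteristic zero enters only there, as the guarantee
    that nonzero polynomials have nonroots. *)

(** * Divisibility and polynomial rings over GCD domains *)

Section Divides.
Variable R : idomainType.
Implicit Types (a b c d g h : R).

(** On [{mpoly K[n]}] this unfolds to [mpoly_dvd]; a version for all integral
    domains is needed to pass between [R] and [{poly R}]. *)
Definition divides g f := exists q : R, f = q * g.

Definition gcd_of a b g :=
  [/\ divides g a, divides g b & forall h, divides h a -> divides h b -> divides h g].

Lemma divides_refl a : divides a a.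
Proof. by exists 1; rewrite mul1r. Qed.

Lemma divides_trans b a c : divides a b -> divides b c -> divides a c.
Proof. by move=> [q ->] [r ->]; exists (r * q); rewrite mulrA. Qed.

Lemma divides0 a : divides a 0.
Proof. by exists 0; rewrite mul0r. Qed.

Lemma divides_mull c a b : divides a b -> divides a (c * b).
Proof. by move=> [q ->]; exists (c * q); rewrite mulrA. Qed.

Lemma divides_mul a b c d : divides a b -> divides c d -> divides (a * c) (b * d).
Proof. by move=> [q ->] [r ->]; exists (q * r); rewrite mulrACA. Qed.

Lemma dividesD a b c : divides a b -> divides a c -> divides a (b + c).
Proof. by move=> [q ->] [r ->]; exists (q + r); rewrite mulrDl. Qed.

Lemma dividesB a b c : divides a b -> divides a c -> divides a (b - c).
Proof. by move=> [q ->] [r ->]; exists (q - r); rewrite mulrBl. Qed.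

Lemma divides_sum a (J : Type) (s : seq J) (F : J -> R) :
  (forall j, divides a (F j)) -> divides a (\sum_(j <- s) F j).
Proof.
by move=> aF; elim/big_rec: _ => [|j x _]; [apply: divides0 | apply: dividesD].
Qed.

Lemma divides_mul2l c a b : c != 0 -> divides (c * a) (c * b) -> divides a b.
Proof.
by move=> c0 [q]; rewrite mulrCA => /(mulfI c0) ->; exists q.
Qed.

Definition gcd_domain := forall a b, exists g, gcd_of a b g.

Hypothesis gcdR : gcd_domain.

Lemma gcd_of_mull c a b g : gcd_of a b g -> gcd_of (c * a) (c * b) (c * g).
Proof.
move=> [ga gb gmax]; have cc := divides_refl c.
split; try exact: divides_mul.
have [->|c0] := eqVneq c 0; first by rewrite !mul0r => h _ _; apply: divides0.
have [h [hca hcb hmax]] := gcdR (c * a) (c * b).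
have [k ck] : divides c h.
  by apply: hmax; rewrite mulrC; apply: divides_mull.
have kg : divides k g.
  by apply: gmax; apply: (divides_mul2l c0); rewrite [c * k]mulrC -ck.
move=> e ea eb; apply: (divides_trans (hmax e ea eb)).
by rewrite ck mulrC; apply: divides_mul.
Qed.

(** Euclid's lemma: [a] is the gcd of [a * d] and [a * b]. *)
Lemma coprime_divides d a b : gcd_of d b 1 -> divides d (a * b) -> divides d a.
Proof.
move=> /(gcd_of_mull a) []; rewrite mulr1 => _ _ amax dab.
by apply: amax => //; apply: divides_mull; apply: divides_refl.
Qed.

Lemma gcd_cofactors a b : b != 0 ->
  exists g a' b', [/\ a = a' * g, b = b' * g & gcd_of a' b' 1].
Proof.
move=> b0; have [g [[a' Ea] [b' Eb] gmax]] := gcdR a b; exists g, a', b'; split=> //.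
have g0 : g != 0 by apply: contra_neq b0 => g0; rewrite Eb g0 mulr0.
split; try by [exists a'; rewrite mulr1 | exists b'; rewrite mulr1].
move=> h ha hb; apply: (divides_mul2l g0); rewrite mulr1.
by apply: gmax; rewrite ?Ea ?Eb [g * h]mulrC; apply: divides_mul => //; exact: divides_refl.
Qed.

End Divides.

Section Content.
Variable R : idomainType.
Hypothesis gcdR : gcd_domain R.
Implicit Types (a b c d : R) (f g h : {poly R}).

Lemma divides_polyC d f : divides d%:P f <-> forall i, divides d f`_i.
Proof.
split=> [[q ->] i|]; first by exists q`_i; rewrite coefMC.
elim/poly_ind: f => [|f a IH] df; first exact: divides0.
apply: dividesD.
  rewrite mulrC; apply/divides_mull/IH => i.
  by have := df i.+1; rewrite coefD coefMX coefC addr0.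
have [q aq] : divides d a by have := df 0%N; rewrite coefD coefMX coefC add0r.
by exists q%:P; rewrite aq polyCM.
Qed.

Definition primitive f := forall d, divides d%:P f -> divides d 1.

Lemma primitive_neq0 f : primitive f -> f != 0.
Proof.
move=> pf; apply/eqP => f0; have [|q] := pf 0; first by rewrite f0; apply: divides0.
by rewrite mulr0 => /eqP; rewrite oner_eq0.
Qed.

Lemma content_exists f : exists c, forall d, divides d%:P f <-> divides d c.
Proof.
elim/poly_ind: f => [|f a [c cP]].
  by exists 0 => d; split => _; apply: divides0.
have [g [ga gc gmax]] := gcdR a c; exists g => d; split.
  move=> /divides_polyC df; apply: gmax.
    by have := df 0%N; rewrite coefD coefMX coefC add0r.
  apply/cP/divides_polyC => i.
  by have := df i.+1; rewrite coefD coefMX coefC addr0.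
move=> dg; apply: dividesD.
  by rewrite mulrC; apply/divides_mull/cP/(divides_trans dg).
by have [q ->] := divides_trans dg ga; exists q%:P; rewrite polyCM.
Qed.

Lemma primitive_part f : exists c g, f = c%:P * g /\ primitive g.
Proof.
have [-> | f0] := eqVneq f 0.
  exists 0, 1; rewrite mul0r; split=> // d /divides_polyC /(_ 0%N).
  by rewrite coefC.
have [c cP] := content_exists f.
have [g Eg] := (cP c).2 (divides_refl c).
have c0 : c != 0 by apply: contra_neq f0 => c0; rewrite Eg c0 mulr0.
exists c, g; split; first by rewrite mulrC.
move=> d [q Eq]; apply: (divides_mul2l c0); rewrite mulr1; apply/cP.
by exists q; rewrite Eg Eq polyCM [c%:P * _]mulrC mulrA.
Qed.

(** The content of [c%:P * f] is [c]: after removing the gcd of [c] and [d],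
    what is left of [d] divides every coefficient of [f]. *)
Lemma divides_content d c f :
  primitive f -> divides d%:P (c%:P * f) -> divides d c.
Proof.
move=> pf dcf; have [-> | c0] := eqVneq c 0; first exact: divides0.
have [g [d' [c' [Ed Ec cop]]]] := gcd_cofactors gcdR d c0.
have g0 : g != 0 by apply: contra_neq c0 => g0; rewrite Ec g0 mulr0.
have [|q] := pf d'.
  apply/divides_polyC => i; apply: (coprime_divides gcdR cop).
  apply: (divides_mul2l g0); move/divides_polyC: dcf => /(_ i).
  by rewrite coefCM Ed Ec [d' * g]mulrC [c' * g]mulrC -mulrA [c' * _]mulrC.
move=> Eq; exists (c' * q); rewrite Ed Ec -mulrA; congr (_ * _).
by rewrite mulrA -Eq mul1r.
Qed.

(** Gauss's lemma.  Without prime elements, the induction shows instead that a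
    constant dividing the product is coprime to both leading coefficients,
    although it divides their product. *)
Lemma primitiveM f g : primitive f -> primitive g -> primitive (f * g).
Proof.
have [k] := ubnP (size f + size g); elim: k => // k IH in f g *.
have lead_coprime (f1 g1 : {poly R}) d : (size f1 + size g1 < k.+1)%N ->
    primitive f1 -> primitive g1 -> divides d%:P (f1 * g1) ->
    gcd_of d (lead_coef f1) 1.
  move=> sz pf pg dfg; split; try by eexists; rewrite mulr1.
  move=> e ed ea; apply: (pf).
  (* [e] divides [a] and the product [f0 * g1] of the lower terms of [f1] with
     [g1]; by induction the latter has the content of [f0] *)
  pose a := lead_coef f1; pose f0 := f1 - a%:P * 'X^((size f1).-1).
  have eaX : divides e%:P (a%:P * 'X^((size f1).-1)).
    rewrite mulrC /a; apply: divides_mull.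
    by have [q ->] := ea; exists q%:P; rewrite polyCM.
  have Ef : f1 = f0 + a%:P * 'X^((size f1).-1) by rewrite subrK.
  rewrite Ef; apply: dividesD => //.
  have [c [h [Eh ph]]] := primitive_part f0.
  have [f00 | f00] := eqVneq f0 0; first by rewrite f00; apply: divides0.
  have c0 : c != 0 by apply: contra_neq f00 => c0; rewrite Eh c0 polyC0 mul0r.
  have sf1 : (0 < size f1)%N by rewrite size_poly_gt0 primitive_neq0.
  have sh : (size h < size f1)%N.
    have <- : size f0 = size h by rewrite Eh size_Cmul.
    rewrite -(prednK sf1) ltnS; apply/leq_sizeP => j; rewrite leq_eqVlt.
    case/predU1P => [<-|lj]; rewrite coefB coefCM coefXn.
      by rewrite eqxx mulr1 subrr.
    by rewrite nth_default ?gtn_eqF ?mulr0 ?subr0 // -(prednK sf1).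
  rewrite Eh mulrC; apply: divides_mull.
  have {}IH : primitive (h * g1).
    by apply: IH => //; rewrite -ltnS (leq_trans _ sz) // ltnS ltn_add2r.
  have [|q ->] := @divides_content e c _ IH; last by exists q%:P; rewrite polyCM.
  rewrite mulrA -Eh mulrBl; apply: dividesB; last first.
    by rewrite mulrC; apply: divides_mull.
  apply: divides_trans dfg.
  by have [q ->] := ed; exists q%:P; rewrite polyCM.
move=> sz pf pg d dfg.
have cf := lead_coprime f g d sz pf pg dfg.
have cg : gcd_of d (lead_coef g) 1.
  by apply: (lead_coprime g f) => //; [rewrite addnC | rewrite mulrC].
apply: (coprime_divides gcdR cg); rewrite mul1r; apply: (coprime_divides gcdR cf).
rewrite mulrC -lead_coefM lead_coefE.
by move/divides_polyC: dfg.
Qed.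

(** Divisibility by a primitive polynomial over the fraction field of [R] is
    divisibility over [R]. *)
Lemma primitive_divides g f h c :
  primitive g -> c != 0 -> c%:P * f = h * g -> divides g f.
Proof.
move=> pg c0 E; have [e [h' [Eh ph]]] := primitive_part h.
have [k Ek] : divides c e.
  apply: (divides_content (primitiveM ph pg)).
  by rewrite mulrA -Eh -E; exists f; rewrite mulrC.
exists (k%:P * h'); apply: (@mulfI _ c%:P); rewrite ?polyC_eq0 //.
by rewrite E Eh Ek polyCM -!mulrA mulrCA.
Qed.

(** The pseudo-gcd of [polydiv] is a gcd over the fraction field of [R]; its
    primitive part times the gcd of the two contents is a gcd over [R].  The
    factor [r] clears the denominators of a Bezout identity; that it is free of
    ['X] is what makes specialization of the coefficients possible. *)
Theorem poly_gcd_bezout f g : exists (d : {poly R}) (r : R) (u v : {poly R}),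
  [/\ gcd_of f g d, r != 0 & r%:P * d = u * f + v * g].
Proof.
have [[-> ->] | fg0] : (f = 0 /\ g = 0) \/ ~~ ((f == 0) && (g == 0)).
  by case: eqP => [->|_] /=; [case: eqP => [->|_]; [left|right]|right].
  exists 0, 1, 0, 0; rewrite !mulr0 addr0 oner_neq0; split=> //.
  by split=> *; exact: divides0.
have [D' [cD [ED]]] : exists D' cD, gcdp f g = cD%:P * D' /\ primitive D'.
  by have [c [g' ?]] := primitive_part (gcdp f g); exists g', c.
move=> pD.
have D0 : gcdp f g != 0 by rewrite gcdp_eq0.
have cD0 : cD != 0 by apply: contra_neq D0 => c0; rewrite ED c0 polyC0 mul0r.
have [cf [f' [Ef pf]]] := primitive_part f.
have [cg [g' [Eg pg]]] := primitive_part g.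
have [c [ccf ccg cmax]] := gcdR cf cg.
have c0 : c != 0.
  apply: contraNneq fg0 => c0; move: ccf ccg; rewrite c0.
  by move=> [q Eq] [r Er]; rewrite Ef Eg Eq Er !mulr0 !mul0r eqxx.
have part h : gcdp f g %| h -> divides D' h.
  case/Pdiv.WeakIdomain.dvdpP => [[k q]] /= k0; rewrite ED -mul_polyC mulrA.
  by apply: primitive_divides.
have part' (h h' : {poly R}) e : h = e%:P * h' -> divides D' h -> divides c e ->
    divides (c%:P * D') h.
  move=> Eh Dh [k Ek]; have [e0 | e0] := eqVneq e 0; last first.
    apply: (@divides_trans _ (e%:P * D')).
      by exists k%:P; rewrite Ek polyCM mulrA.
    rewrite Eh; apply: divides_mul; first exact: divides_refl.
    have [q Eq] := Dh; apply: (primitive_divides pD e0 (h := q)).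
    by rewrite -Eh.
  by rewrite Eh e0 polyC0 mul0r; apply: divides0.
have [[u v] /= /eqpP [[c1 c2] /= /andP[c10 c20]]] := Bezoutp f g.
rewrite ED -!mul_polyC => Bz.
have Bz' : (c2 * cD)%:P * (c%:P * D') = (c%:P * c1%:P * u) * f + (c%:P * c1%:P * v) * g.
  by rewrite -!mulrA -!mulrDr mulrCA Bz polyCM -!mulrA.
exists (c%:P * D'), (c2 * cD), (c%:P * c1%:P * u), (c%:P * c1%:P * v).
have r0 : c2 * cD != 0 by rewrite mulf_neq0.
split=> //; split.
- by apply: (part' _ _ _ Ef) => //; apply/part/dvdp_gcdl.
- by apply: (part' _ _ _ Eg) => //; apply/part/dvdp_gcdr.
move=> h hf hg.
have [e [h' [Eh ph]]] := primitive_part h.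
have eh : divides e%:P h by exists h'; rewrite Eh mulrC.
have h'h : divides h' h by exists e%:P.
rewrite Eh; apply: divides_mul.
  have [||q ->] := cmax e; last by exists q%:P; rewrite polyCM.
    by apply: (divides_content pf); rewrite -Ef; apply: divides_trans hf.
  by apply: (divides_content pg); rewrite -Eg; apply: divides_trans hg.
have [q Eq] : divides h' ((c2 * cD * c)%:P * D').
  rewrite polyCM -mulrA Bz'.
  by apply: dividesD; apply/divides_mull/(divides_trans h'h).
by apply: primitive_divides ph _ Eq; rewrite mulf_neq0.
Qed.

End Content.

(** * Multivariate polynomials over a field form a GCD domain *)

Section MpolyMorphisms.

Lemma mpoly_rmorph_eq n (A : idomainType) (S : comNzRingType)
    (f g : {rmorphism {mpoly A[n]} -> S}) :
  (forall c, f c%:MP = g c%:MP) -> (forall i, f 'X_i = g 'X_i) -> f =1 g.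
Proof.
move=> fgC fgX; elim/mpolyind => [|c m p _ _ IH]; first by rewrite !rmorph0.
rewrite !rmorphD IH -mul_mpolyC !rmorphM fgC; congr (_ * _ + _).
rewrite mpolyXE_id !rmorph_prod; apply: eq_bigr => i _.
by rewrite !rmorphXn fgX.
Qed.

Lemma mmapXi n (A S : nzRingType) (f : {rmorphism A -> S}) (h : 'I_n -> S) i :
  mmap f h 'X_i = h i.
Proof. by rewrite mmapX mmap1U. Qed.

End MpolyMorphisms.

Lemma gcd_domain_iso (R S : idomainType) (f : {rmorphism R -> S})
    (g : {rmorphism S -> R}) :
  cancel f g -> cancel g f -> gcd_domain S -> gcd_domain R.
Proof.
move=> fK gK gcdS a b; have [d [da db dmax]] := gcdS (f a) (f b).
have transfer u v : divides u (f v) -> divides (g u) v.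
  by move=> [q Eq]; exists (g q); rewrite -rmorphM -Eq fK.
exists (g d); split; try exact: transfer.
move=> h ha hb; have [||q Eq] := dmax (f h).
- by have [q ->] := ha; exists (f q); rewrite rmorphM.
- by have [q ->] := hb; exists (f q); rewrite rmorphM.
by exists (g q); rewrite Eq rmorphM fK.
Qed.

Section MpolyGcd.
Variable K : fieldType.

(** The first variable becomes the variable of the univariate polynomials. *)
Definition mpoly_to_poly n : {mpoly K[n.+1]} -> {poly {mpoly K[n]}} :=
  mmap (polyC \o @mpolyC n K) (fun i => if unlift ord0 i is Some j then ('X_j)%:P else 'X).

Definition mpoly_shift n : {mpoly K[n]} -> {mpoly K[n.+1]} :=
  mmap (@mpolyC n.+1 K) (fun j => 'X_(lift ord0 j)).

HB.instance Definition _ n := GRing.RMorphism.on (@mpoly_to_poly n).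
HB.instance Definition _ n := GRing.RMorphism.on (@mpoly_shift n).

Definition poly_to_mpoly n : {poly {mpoly K[n]}} -> {mpoly K[n.+1]} :=
  horner_eval 'X_ord0 \o map_poly (@mpoly_shift n).

HB.instance Definition _ n := GRing.RMorphism.on (@poly_to_mpoly n).

Lemma poly_to_mpolyE n (p : {poly {mpoly K[n]}}) :
  poly_to_mpoly p = (map_poly (@mpoly_shift n) p).['X_ord0].
Proof. by []. Qed.

Lemma mpoly_to_polyC n c : @mpoly_to_poly n c%:MP = c%:MP%:P.
Proof. by rewrite /mpoly_to_poly mmapC. Qed.

Lemma mpoly_to_polyX0 n : @mpoly_to_poly n 'X_ord0 = 'X.
Proof. by rewrite /mpoly_to_poly mmapXi unlift_none. Qed.

Lemma mpoly_to_polyXS n j : @mpoly_to_poly n 'X_(lift ord0 j) = ('X_j)%:P.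
Proof. by rewrite /mpoly_to_poly mmapXi liftK. Qed.

Lemma mpoly_shiftC n c : @mpoly_shift n c%:MP = c%:MP.
Proof. by rewrite /mpoly_shift mmapC. Qed.

Lemma mpoly_shiftX n j : @mpoly_shift n 'X_j = 'X_(lift ord0 j).
Proof. by rewrite /mpoly_shift mmapXi. Qed.

Lemma mpoly_to_polyK n : cancel (@mpoly_to_poly n) (@poly_to_mpoly n).
Proof.
apply: (@mpoly_rmorph_eq n.+1 K _ (@poly_to_mpoly n \o @mpoly_to_poly n) idfun) => [c|i] /=.
  by rewrite mpoly_to_polyC poly_to_mpolyE map_polyC /= hornerC mpoly_shiftC.
case: (unliftP ord0 i) => [j|] ->.
  by rewrite mpoly_to_polyXS poly_to_mpolyE map_polyC /= hornerC mpoly_shiftX.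
by rewrite mpoly_to_polyX0 poly_to_mpolyE map_polyX hornerX.
Qed.

Lemma mpoly_shift_to_poly n (p : {mpoly K[n]}) : mpoly_to_poly (mpoly_shift p) = p%:P.
Proof.
apply: (@mpoly_rmorph_eq n K _ (@mpoly_to_poly n \o @mpoly_shift n) polyC) => [c|i] /=.
  by rewrite mpoly_shiftC mpoly_to_polyC.
by rewrite mpoly_shiftX mpoly_to_polyXS.
Qed.

Lemma poly_to_mpolyK n : cancel (@poly_to_mpoly n) (@mpoly_to_poly n).
Proof.
elim/poly_ind => [|p c IH]; first by rewrite !rmorph0.
rewrite !rmorphD !rmorphM /= IH !poly_to_mpolyE map_polyX map_polyC hornerX hornerC /=.
by rewrite mpoly_to_polyX0 mpoly_shift_to_poly.
Qed.

(** By induction on [n]; without variables, the nonzero polynomials are units. *)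
Lemma mpoly_gcd_domain n : gcd_domain {mpoly K[n]}.
Proof.
elim: n => [|n IH]; last first.
  apply: (gcd_domain_iso (@mpoly_to_polyK n) (@poly_to_mpolyK n)) => f g.
  by have [d [_ [_ [_ [? _ _]]]]] := poly_gcd_bezout IH f g; exists d.
move=> a b; have [-> | a0] := eqVneq a 0.
  by exists b; split=> //; [apply: divides0 | apply: divides_refl].
have unit_a c : divides a c.
  have Ea : a = (a@_0)%:MP.
    by apply: msize1_polyC; rewrite msizeE; apply/bigmax_leqP_seq => m _ _; rewrite mdegE big_ord0.
  exists (c * (a@_0)^-1%:MP); rewrite -mulrA {2}Ea -mpolyCM mulVf ?mpolyC1 ?mulr1 //.
  by apply: contra_neq a0 => E; rewrite Ea E mpolyC0.
by exists a; split=> //.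
Qed.

End MpolyGcd.

(** * Common divisors survive restriction to a generic line *)

Lemma list_gcd (R : idomainType) (fs : seq R) : gcd_domain R ->
  exists d, (forall f, f \in fs -> divides d f) /\
    forall h, (forall f, f \in fs -> divides h f) -> divides h d.
Proof.
move=> gcdR; elim: fs => [|f fs [d [dfs dmax]]].
  by exists 0; split=> // h _; apply: divides0.
have [e [ef ed emax]] := gcdR f d; exists e; split=> [g|h hfs].
  by rewrite inE => /predU1P [-> // | /dfs]; apply: divides_trans.
apply: emax; first by apply: hfs; rewrite mem_head.
by apply: dmax => g gfs; apply: hfs; rewrite inE gfs orbT.
Qed.

Lemma list_gcd_bezout (R : idomainType) (fs : seq {poly R}) : gcd_domain R ->
  exists (d : {poly R}) (r : R) (a : nat -> {poly R}),
    [/\ forall f, f \in fs -> divides d f, r != 0 &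
        r%:P * d = \sum_(i < size fs) a i * fs`_i].
Proof.
move=> gcdR; elim: fs => [|f fs [d [r [a [dfs r0 Bz]]]]].
  by exists 0, 1, (fun=> 0); rewrite oner_neq0 big_ord0 mulr0; split.
have [e [s [u [v [[ef ed _] s0 Bz']]]]] := poly_gcd_bezout gcdR f d.
exists e, (r * s), (fun i => if i is j.+1 then v * a j else r%:P * u); split.
- by move=> g; rewrite inE => /predU1P [-> // | /dfs]; apply: divides_trans.
- by rewrite mulf_neq0.
rewrite /= big_ord_recl /= polyCM -mulrA Bz' mulrDr mulrA; congr (_ + _).
rewrite mulrCA Bz mulr_sumr; apply: eq_bigr => i _.
by rewrite mulrA.
Qed.

Section LineRestriction.
Variables (K : fieldType) (n : nat).
Local Notation P := {mpoly K[n]}.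
Implicit Types (p q : 'rV[K]_n) (f g h : P).

(** Restriction to the line spanned by [p] and [q], with coordinate ['X] along
    [p] and [1] along [q]. *)
Definition restrict p q : P -> {poly K} :=
  mmap polyC (fun j => p 0 j *: 'X + (q 0 j)%:P).

(** The direction [q] is replaced by the generic point of the affine space. *)
Definition generic_restrict p : P -> {poly P} :=
  mmap (polyC \o @mpolyC n K) (fun j => (p 0 j)%:MP *: 'X + ('X_j)%:P).

HB.instance Definition _ p q := GRing.RMorphism.on (restrict p q).
HB.instance Definition _ p := GRing.RMorphism.on (generic_restrict p).

Lemma restrictC p q c : restrict p q c%:MP = c%:P.
Proof. by rewrite /restrict mmapC. Qed.

Lemma restrictX p q j : restrict p q 'X_j = p 0 j *: 'X + (q 0 j)%:P.
Proof. by rewrite /restrict mmapXi. Qed.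

Lemma generic_restrictC p c : generic_restrict p c%:MP = c%:MP%:P.
Proof. by rewrite /generic_restrict mmapC. Qed.

Lemma generic_restrictX p j :
  generic_restrict p 'X_j = (p 0 j)%:MP *: 'X + ('X_j)%:P.
Proof. by rewrite /generic_restrict mmapXi. Qed.

Lemma generic_restrict_eval p q f :
  map_poly (meval (q 0)) (generic_restrict p f) = restrict p q f.
Proof.
move: f; apply: (@mpoly_rmorph_eq n K _
  (map_poly (meval (q 0)) \o generic_restrict p) (restrict p q)) => [c|i] /=.
  by rewrite generic_restrictC restrictC map_polyC /= mevalC.
rewrite generic_restrictX restrictX rmorphD /= map_polyZ /= map_polyX.
by rewrite map_polyC /= mevalC mevalXU.
Qed.

(** The endomorphism of [{poly P}] that moves the generic point by [p 'X] and
    fixes ['X].  It is invertible, which shows that [generic_restrict p f] has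
    the same divisors as the constant polynomial [f%:P]. *)
Definition translate p : {poly P} -> {poly P} :=
  horner_eval 'X \o map_poly (generic_restrict p).

HB.instance Definition _ p := GRing.RMorphism.on (translate p).

Lemma translateE p (F : {poly P}) :
  translate p F = (map_poly (generic_restrict p) F).['X].
Proof. by []. Qed.

Lemma translateC p f : translate p f%:P = generic_restrict p f.
Proof. by rewrite translateE map_polyC hornerC. Qed.

Lemma translateX p : translate p 'X = 'X.
Proof. by rewrite translateE map_polyX hornerX. Qed.

Lemma translate_generic_restrict p f : translate (- p) (generic_restrict p f) = f%:P.
Proof.
move: f; apply: (@mpoly_rmorph_eq n K _
  (translate (- p) \o generic_restrict p) polyC) => [c|i] /=.
  by rewrite generic_restrictC translateC generic_restrictC.
rewrite generic_restrictX -mul_polyC rmorphD rmorphM /= translateX !translateC.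
rewrite generic_restrictC generic_restrictX mxE mpolyCN scaleNr addrA -mul_polyC.
by rewrite subrr add0r.
Qed.

Lemma translateNK p : cancel (translate (- p)) (translate p).
Proof.
have MXaddC r (F : {poly P}) (c : P) :
    translate r (F * 'X + c%:P) = translate r F * 'X + generic_restrict r c.
  by rewrite rmorphD rmorphM /= translateX translateC.
have step r (F f : {poly P}) : translate r (F * 'X + f) = translate r F * 'X + translate r f.
  by rewrite rmorphD rmorphM /= translateX.
elim/poly_ind => [|F c IH]; first by rewrite !rmorph0.
rewrite (MXaddC (- p) F c) (step p _ (generic_restrict (- p) c)) IH; congr (_ + _).
by have := translate_generic_restrict (- p) c; rewrite opprK.
Qed.

(** Translating back by [- p] turns the restricted polynomials into the
    constants [f%:P], so a common divisor becomes constant, and then divides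
    [G]; the Bezout identity for the gcd in [{poly P}] thus has a multiple for
    the restriction of [G]. *)
Lemma generic_restrict_bezout p (fs : seq P) G :
  (exists2 f, f \in fs & f != 0) ->
  (forall h, (forall f, f \in fs -> divides h f) -> divides h G) ->
  exists (r : P) (a : nat -> {poly P}), r != 0 /\
    r%:P * generic_restrict p G = \sum_(i < size fs) a i * generic_restrict p fs`_i.
Proof.
move=> [f0 f0fs f00] Gmax.
have [d [r [a [dfs r0 Bz]]]] :=
  list_gcd_bezout [seq generic_restrict p f | f <- fs] (@mpoly_gcd_domain K n).
have div_d f : f \in fs -> divides (translate (- p) d) f%:P.
  move=> /(map_f (generic_restrict p)) /dfs [q Eq]; exists (translate (- p) q).
  by rewrite -(translate_generic_restrict p f) Eq; apply: rmorphM.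
have [c Ec] : exists c, translate (- p) d = c%:P.
  exists (translate (- p) d)`_0; apply/size1_polyC.
  have [q Eq] := div_d _ f0fs.
  have qd0 : q * translate (- p) d != 0 by rewrite -Eq polyC_eq0.
  move: qd0 (congr1 (fun F : {poly P} => size F) Eq).
  rewrite mulf_eq0 negb_or => /andP [q0 d0]; rewrite size_mul // size_polyC f00 /= => E.
  move: q0 d0 E; rewrite -!size_poly_gt0.
  by move: (size q) (size (translate (- p) d)) => x y; lia.
have [q Eq] : divides d (generic_restrict p G).
  have [|q Eq] := Gmax c.
    move=> f /div_d; rewrite Ec => /divides_polyC /(_ 0%N).
    by rewrite coefC.
  have -> : d = generic_restrict p c by rewrite -(translateC p c) -Ec translateNK.
  by exists (generic_restrict p q); rewrite Eq; apply: rmorphM.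
exists r, (fun i => q * a i); split=> //.
rewrite Eq mulrCA Bz size_map mulr_sumr; apply: eq_bigr => i _.
by rewrite (nth_map 0) // mulrA.
Qed.

(** Restriction to a generic line through [p] creates no new common divisor:
    the identity of [generic_restrict_bezout] is specialized at [q]. *)
Lemma restrict_gcd p (fs : seq P) G :
  (exists2 f, f \in fs & f != 0) ->
  (forall h, (forall f, f \in fs -> divides h f) -> divides h G) ->
  exists2 r : P, r != 0 & forall q (u : {poly K}), r.@[q 0] != 0 ->
    (forall f, f \in fs -> divides u (restrict p q f)) ->
    divides u (restrict p q G).
Proof.
move=> fs0 Gmax; have [r [a [r0 Bz]]] := generic_restrict_bezout p fs0 Gmax.
exists r => // q u rq ufs.
have [s Es] : divides u ((r.@[q 0])%:P * restrict p q G).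
  have -> : (r.@[q 0])%:P * restrict p q G =
      \sum_(i < size fs) map_poly (meval (q 0)) (a i) * restrict p q fs`_i.
    rewrite -generic_restrict_eval -(map_polyC (meval (q 0))) -rmorphM Bz rmorph_sum.
    by apply: eq_bigr => i _; rewrite rmorphM /= generic_restrict_eval.
  by apply: divides_sum => i; apply/divides_mull/ufs/mem_nth.
exists (((r.@[q 0])^-1)%:P * s).
by rewrite -mulrA -Es mulrA -polyCM mulVf // polyC1 mul1r.
Qed.

End LineRestriction.

(** * Maximal growth in two variables *)

Lemma size_rVpoly (K : fieldType) m (v : 'rV[K]_m) : (size (rVpoly v) <= m)%N.
Proof. exact: size_poly. Qed.

Section BinaryGrowth.
Variables (K : fieldType) (d : nat).
Variables (V : {vspace 'rV[K]_d.+1}) (W : {vspace 'rV[K]_d.+2}).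

Let inV (u : {poly K}) := (size u <= d.+1)%N /\ poly_rV u \in V.

Let inV_rVpoly v : v \in V -> inV (rVpoly v).
Proof. by split; [apply: size_poly | rewrite rVpolyK]. Qed.

Let inVD u v : inV u -> inV v -> inV (u + v).
Proof.
move=> [su uV] [sv vV]; split; last by rewrite linearD memvD.
by rewrite (leq_trans (size_polyD _ _)) // geq_max su.
Qed.

Let inVZ c u : inV u -> inV (c *: u).
Proof.
by move=> [su uV]; split; [apply: leq_trans (size_scale_leq _ _) su | rewrite linearZ memvZ].
Qed.

Let inV_sum k (F : nat -> {poly K}) : (forall i, (i < k)%N -> inV (F i)) -> inV (\sum_(i < k) F i).
Proof.
elim: k => [|k IH] FV.
  by rewrite big_ord0; split; rewrite ?size_poly0 // linear0 mem0v.
rewrite big_ord_recr; apply: inVD; last exact: FV.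
by apply: IH => i ik; apply: FV; apply: ltnW.
Qed.

Variable f : {poly K}.
Hypothesis sizef : size f = d.+1.
Hypothesis fV : poly_rV f \in V.
Hypothesis VW : forall v, v \in V -> poly_rV (rVpoly v) \in W.
Hypothesis XVW : forall v, v \in V -> poly_rV ('X * rVpoly v) \in W.
Hypothesis dimW : \dim W = (\dim V).+1.

Let Xf_W : poly_rV ('X * f) \in W.
Proof. by have := XVW fV; rewrite poly_rV_K ?sizef. Qed.

(** [V] is exactly the part of [W] of degree at most [d]: that part is proper,
    as ['X * f] lies outside it, while [V] has codimension one in [W]. *)
Let W_small_inV (u : {poly K}) : (size u <= d.+1)%N -> poly_rV u \in W -> inV u.
Proof.
pose iota : 'Hom('rV[K]_d.+1, 'rV[K]_d.+2) := linfun (poly_rV \o rVpoly).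
have iotaE v : iota v = poly_rV (rVpoly v) by rewrite lfunE.
have iota_inj : injective iota.
  move=> v w; rewrite !iotaE => /(congr1 rVpoly).
  by rewrite !poly_rV_K ?(leq_trans (size_rVpoly _)) // => /(can_inj rVpolyK).
have dim_iotaV : \dim (iota @: V) = \dim V.
  by apply: limg_dim_eq; move/lker0P: iota_inj => /eqP ->; rewrite capv0.
pose W0 := (W :&: iota @: fullv)%VS.
have iotaVW0 : (iota @: V <= W0)%VS.
  rewrite subv_cap limgS ?subvf // andbT.
  by apply/subvP => _ /memv_imgP[v vV ->]; rewrite iotaE VW.
(* [W0] is the part of [W] of degree at most [d] *)
have Xf_W0 : poly_rV ('X * f) \notin W0.
  rewrite memv_cap negb_and; apply/orP; right; apply/memv_imgP => -[v _].
  rewrite iotaE => /(congr1 rVpoly); rewrite !poly_rV_K ?(leq_trans (size_rVpoly _)) //.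
    move=> E; have := size_rVpoly v.
    by rewrite -E size_mul ?polyX_eq0 -?size_poly_gt0 ?sizef // size_polyX ltnn.
  by rewrite size_mul ?polyX_eq0 -?size_poly_gt0 ?sizef // size_polyX.
have eq_W0 : (iota @: V)%VS = W0.
  apply/eqP; rewrite eqEdim iotaVW0 dim_iotaV -ltnS -dimW /=.
  rewrite ltn_neqAle dimvS ?capvSl // andbT; apply: contraNneq Xf_W0 => dW0.
  have -> : W0 = W by apply/eqP; rewrite eqEdim capvSl dW0 leqnn.
  exact: Xf_W.
move=> su uW; split=> //.
have : poly_rV u \in W0.
  rewrite memv_cap uW /=; apply/memv_imgP; exists (poly_rV u); rewrite ?memvf //.
  by rewrite iotaE poly_rV_K.
rewrite -eq_W0 => /memv_imgP[v vV]; rewrite iotaE => /(congr1 rVpoly).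
rewrite !poly_rV_K ?(leq_trans (size_rVpoly _)) ?(leq_trans su) // => ->.
by rewrite rVpolyK.
Qed.

Let inV_mulX (u : {poly K}) : (size u <= d)%N -> inV u -> inV ('X * u).
Proof.
move=> su [su' uV]; apply: W_small_inV.
  by rewrite (leq_trans (size_polyMleq _ _)) // size_polyX.
by rewrite -(poly_rV_K su') XVW.
Qed.

(** Let [g] be of least degree in [V].  As [V] is stable under multiplication by
    ['X] as long as the degree stays at most [d], it contains every multiple of
    [g] of degree at most [d], and Euclidean division by [g] shows that it
    contains nothing else.  The elements of [W] differ from elements of [V] by
    multiples of ['X * f]. *)
Lemma binary_maximal_growth : exists2 g, g \in V &
  [/\ (size (rVpoly g) + \dim V = d.+2)%N,
      forall v, v \in V -> divides (rVpoly g) (rVpoly v) &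
      forall w, w \in W -> divides (rVpoly g) (rVpoly w)].
Proof.
have f0 : f != 0 by rewrite -size_poly_gt0 sizef.
have [g [gV g0 gmin]] : exists g, [/\ inV g, g != 0 &
    forall u, inV u -> (size u < size g)%N -> u = 0].
  have: inV f by rewrite /inV sizef.
  move: f0; have [k] := ubnP (size f); move: (f); elim: k => // k IH u su u0 uV.
  have [[v [vV v0 sv]] | noV] := classic (exists v, [/\ inV v, v != 0 & (size v < size u)%N]).
    by apply: (IH v) => //; rewrite -ltnS (leq_trans _ su).
  exists u; split=> // v vV sv; apply/eqP/negPn/negP => v0.
  by apply: noV; exists v.
have [sg gV'] := gV.
have g_gt0 : (0 < size g)%N by rewrite size_poly_gt0.
have Xig i : (size g + i <= d.+1)%N -> inV ('X^i * g).
  elim: i => [|i IH] le; first by rewrite mul1r.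
  rewrite exprS -mulrA; apply: inV_mulX; last by apply: IH; rewrite ltnW // -addnS.
  by rewrite (leq_trans (size_polyMleq _ _)) // size_polyXn addSn /= addnC -ltnS -addnS.
have qgV (q : {poly K}) : (size q + size g <= d.+2)%N -> inV (q * g).
  move=> le; rewrite -[q]coefK poly_def mulr_suml; apply: (@inV_sum _ (fun i => q`_i *: 'X^i * g)).
  move=> i iq; rewrite -scalerAl; apply/inVZ/Xig.
  by rewrite -ltnS -addnS (leq_trans _ le) // addnC leq_add2r.
have g_dvd u : inV u -> divides g u.
  move=> uV; exists (u %/ g).
  have [-> | u0] := eqVneq u 0; first by rewrite div0p mul0r.
  rewrite {1}(Pdiv.Field.divp_eq u g); suff -> : u %% g = 0 by rewrite addr0.
  apply: gmin; last by rewrite ltn_modp.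
  have -> : u %% g = u + (-1) *: (u %/ g * g).
    by rewrite scaleN1r {2}(Pdiv.Field.divp_eq u g) addrC addKr.
  apply/inVD/inVZ/qgV => //; rewrite size_divp //.
  have [le | lt] := leqP (size g) (size u); last first.
    rewrite (_ : _ - _ = 0)%N ?add0n ?(leq_trans sg) //.
    by apply/eqP; rewrite subn_eq0 -ltnS prednK.
  rewrite -{2}(prednK g_gt0) addnS subnK ?(leq_trans (leq_pred _)) //.
  by rewrite ltnS; case: uV.
exists (poly_rV g); rewrite ?poly_rV_K //; split=> //.
- pose mulg : 'Hom('rV[K]_(d.+2 - size g), 'rV[K]_d.+1) := linfun (poly_rV \o (g \o* rVpoly)).
  have mulgE v : mulg v = poly_rV (rVpoly v * g) by rewrite lfunE.
  have smul v : (size (@rVpoly K (d.+2 - size g) v * g)%R <= d.+1)%N.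
    by have := size_polyMleq (rVpoly v) g; have := size_rVpoly v; lia.
  have <- : (mulg @: fullv)%VS = V.
    apply/vspaceP => v; apply/memv_imgP/idP => [[w _ ->] | vV].
      rewrite mulgE; apply: (qgV _ _).2.
      by have := size_rVpoly w; lia.
    have [q Eq] := g_dvd _ (inV_rVpoly vV).
    exists (poly_rV q); rewrite ?memvf // mulgE poly_rV_K -?Eq ?rVpolyK //.
    have [-> | q0] := eqVneq q 0; first by rewrite size_poly0.
    have := size_rVpoly v; rewrite Eq size_mul // => le.
    by move: le sg; move: (size q) (size g) => a b; lia.
  have /lker0P/eqP mulg_inj : injective mulg; last first.
    by rewrite limg_dim_eq ?mulg_inj ?capv0 // dimvf dim_matrix mul1r subnKC ?(leq_trans sg).
  move=> v w; rewrite !mulgE => /(congr1 rVpoly).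
  by rewrite !poly_rV_K // => /(mulIf g0) /(can_inj rVpolyK).
- by move=> v /inV_rVpoly /g_dvd.
move=> w wW.
have fd0 : f`_d != 0 by rewrite -[d]/(d.+1.-1) -sizef -lead_coefE lead_coef_eq0.
pose c := (rVpoly w)`_d.+1 / f`_d.
have gXf : divides g (c *: ('X * f)).
  rewrite -mul_polyC; do 2!apply: divides_mull; apply: g_dvd.
  by rewrite /inV sizef.
rewrite -[rVpoly w](subrK (c *: ('X * f))); apply: dividesD => //.
apply: g_dvd; apply: W_small_inV.
  apply/leq_sizeP => j; rewrite leq_eqVlt coefB coefZ coefXM.
  case/predU1P => [<-|lj].
    by rewrite /= /c divfK ?subrr.
  rewrite nth_default ?(leq_trans (size_rVpoly _)) // nth_default ?if_same ?mulr0 ?subrr //.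
  by rewrite sizef -ltnS; case: j lj.
rewrite linearB linearZ /= rVpolyK memvB ?memvZ //.
Qed.

End BinaryGrowth.

(** * Degrees of restrictions, and ideals given by generators *)

Section RestrictDegree.
Variables (K : fieldType) (n : nat) (p q : 'rV[K]_n).
Implicit Types (f : {mpoly K[n]}) (u v : {poly K}).

(** The leading behaviour of the restriction of a form of degree [s]: its
    coefficient in degree [s] is the value of the form at [p]. *)
Let lead_at s u (a : K) := (size u <= s.+1)%N /\ u`_s = a.

Let lead_atM s t u v a b : lead_at s u a -> lead_at t v b -> lead_at (s + t) (u * v) (a * b).
Proof.
move=> [su <-] [sv <-]; split; first by have := size_polyMleq u v; lia.
rewrite coefM (bigD1 (inord s)) //= inordK ?ltnS ?leq_addr // addKn big1 ?addr0 // => i.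
rewrite -val_eqE /= inordK ?ltnS ?leq_addr // neq_ltn => /orP[] i_s.
  rewrite [X in _ * X]nth_default ?mulr0 // (leq_trans sv) //; lia.
by rewrite nth_default ?mul0r // (leq_trans su).
Qed.

Lemma restrict_monomial (m : 'X_{1..n}) :
  (size (restrict p q 'X_[m]) <= (mdeg m).+1)%N /\
  (restrict p q 'X_[m])`_(mdeg m) = 'X_[m].@[p 0].
Proof.
rewrite -/(lead_at _ _ _) mpolyXE_id mdegE !rmorph_prod /=.
apply: (big_rec3 (fun s u a => lead_at s u a)) => [|j s u a _ IH].
  by split; rewrite ?size_poly1 // coef1.
apply: lead_atM => //; elim: (m j) => [|k IHk].
  by split; rewrite ?rmorph1 ?size_poly1 // coef1.
rewrite !exprS !rmorphM; apply: (@lead_atM 1) => //; rewrite /= restrictX mevalXU.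
split; last by rewrite coefD coefZ coefX coefC mulr1 addr0.
rewrite (leq_trans (size_polyD _ _)) // geq_max (leq_trans (size_scale_leq _ _)) ?size_polyX //.
by rewrite (leq_trans (size_polyC_leq1 _)).
Qed.

Lemma restrictZ a f : restrict p q (a *: f) = a *: restrict p q f.
Proof. by rewrite /restrict mmapZ mul_polyC. Qed.

Lemma size_restrict f : (size (restrict p q f) <= msize f)%N.
Proof.
rewrite {1}(mpolyE f) rmorph_sum /=.
have: forall m, m \in msupp f -> (mdeg m < msize f)%N by move=> m; apply: msize_mdeg_lt.
elim: (msupp f) => [|m s IH] ms; first by rewrite big_nil size_poly0.
rewrite big_cons (leq_trans (size_polyD _ _)) // geq_max IH ?andbT => [|x xs]; last first.
  by apply: ms; rewrite inE xs orbT.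
rewrite restrictZ (leq_trans (size_scale_leq _ _)) //.
by rewrite (leq_trans (restrict_monomial m).1) // ms ?mem_head.
Qed.

Lemma coef_restrict d f : f \is d.-homog -> (restrict p q f)`_d = f.@[p 0].
Proof.
move=> /dhomogP fd; rewrite (mpolyE f) !rmorph_sum coef_sum /=.
rewrite big_seq [RHS]big_seq; apply: eq_bigr => m mf.
by rewrite restrictZ coefZ mevalZ -(restrict_monomial m).2 fd.
Qed.

Lemma size_restrict_dhomog d f : f \is d.-homog -> (size (restrict p q f) <= d.+1)%N.
Proof.
move=> /dhomogP fd; rewrite (leq_trans (size_restrict f)) // msizeE.
by apply/bigmax_leqP_seq => m mf _; rewrite fd.
Qed.

Lemma size_restrict_eq d f : f \is d.-homog -> f.@[p 0] != 0 -> size (restrict p q f) = d.+1.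
Proof.
move=> fd fp; apply/eqP; rewrite eqn_leq size_restrict_dhomog //= ltnNge.
by apply: contra fp => le; rewrite -(coef_restrict fd) nth_default.
Qed.

Lemma restrict_linear_form m (c : 'M[K]_(m, n)) k :
  restrict p q (linear_form c k) = (c *m p^T) k 0 *: 'X + ((c *m q^T) k 0)%:P.
Proof.
rewrite /linear_form rmorph_sum !mxE scaler_suml rmorph_sum -big_split /=.
apply: eq_bigr => j _.
by rewrite restrictZ restrictX !mxE scalerDr scalerA polyCM mul_polyC.
Qed.

End RestrictDegree.

Lemma linear_form_dhomog (K : fieldType) n m (c : 'M[K]_(m, n)) k :
  linear_form c k \is 1.-homog.
Proof. by rewrite rpred_sum // => j _; rewrite rpredZ // dhomogX /= mdeg1. Qed.

Section IdealGen.
Variables (K : fieldType) (n : nat).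
Implicit Types (S : {mpoly K[n]} -> Prop) (f g : {mpoly K[n]}).

Lemma ideal_gen_ideal S : is_ideal (ideal_gen S).
Proof.
split.
- by exists 0%N, (fun=> 0), (fun=> 0); rewrite big_ord0; split=> // -[].
- move=> f g [k [a [s [sS ->]]]] [l [b [t [tS ->]]]].
  pose glue (u : 'I_k -> {mpoly K[n]}) (v : 'I_l -> {mpoly K[n]}) (i : 'I_(k + l)) :=
    match split i with inl j => u j | inr j => v j end.
  exists (k + l)%N, (glue a b), (glue s t); split.
    by move=> i; rewrite /glue; case: split.
  by rewrite big_split_ord /=; congr (_ + _); apply: eq_bigr => i _;
    rewrite /glue; [rewrite (unsplitK (inl i)) | rewrite (unsplitK (inr i))].
move=> f g [k [a [s [sS ->]]]]; exists k, (fun i => f * a i), s; split=> //.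
by rewrite mulr_sumr; apply: eq_bigr => i _; rewrite mulrA.
Qed.

Lemma ideal_gen_sub S f : S f -> ideal_gen S f.
Proof. by move=> Sf; exists 1%N, (fun=> 1), (fun=> f); rewrite big_ord1 mul1r. Qed.

Lemma ideal_sum (J : {mpoly K[n]} -> Prop) (T : Type) (s : seq T) (F : T -> {mpoly K[n]}) :
  is_ideal J -> (forall i, J (F i)) -> J (\sum_(i <- s) F i).
Proof. by move=> [J0 JD _] JF; elim/big_rec: _ => // i x _; apply: JD. Qed.

End IdealGen.

(** * Restriction to a line as reduction modulo linear forms *)

Section LinearForms.
Variables (K : fieldType) (n : nat).

Lemma linear_formD m (a b : 'M[K]_(m, n)) k :
  linear_form (a + b) k = linear_form a k + linear_form b k.
Proof. by rewrite -big_split; apply: eq_bigr => j _; rewrite mxE scalerDl. Qed.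

Lemma linear_form_mulmx m l (a : 'M[K]_(l, m)) (c : 'M_(m, n)) k :
  linear_form (a *m c) k = \sum_i a k i *: linear_form c i.
Proof.
under [RHS]eq_bigr do rewrite scaler_sumr.
rewrite exchange_big; apply: eq_bigr => j _; rewrite mxE scaler_suml.
by apply: eq_bigr => i _; rewrite scalerA.
Qed.

Lemma linear_form1 k : linear_form (1%:M : 'M[K]_n) k = 'X_k.
Proof.
rewrite /linear_form (bigD1 k) //= mxE eqxx scale1r big1 ?addr0 // => j jk.
by rewrite mxE eq_sym (negbTE jk) scale0r.
Qed.

End LinearForms.

Section FormsIdeal.
Variables (K : fieldType) (n m : nat).
Implicit Types (f g : {mpoly K[n]}) (I : {mpoly K[n]} -> Prop) (c : 'M[K]_(m, n)).

Definition forms_ideal c : {mpoly K[n]} -> Prop :=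
  ideal_gen (fun f => exists k, f = linear_form c k).

Lemma forms_ideal_ideal c : is_ideal (forms_ideal c).
Proof. exact: ideal_gen_ideal. Qed.

Lemma forms_ideal_sum c (a : 'I_m -> {mpoly K[n]}) :
  forms_ideal c (\sum_k a k * linear_form c k).
Proof.
apply: ideal_sum => [|k]; first exact: forms_ideal_ideal.
by have [_ _] := forms_ideal_ideal c; apply; apply: ideal_gen_sub; exists k.
Qed.

Lemma forms_idealP c f :
  forms_ideal c f -> exists a : 'I_m -> {mpoly K[n]}, f = \sum_k a k * linear_form c k.
Proof.
move=> [k [a [g [gL ->]]]]; elim/big_rec: _ => [|i x _ [b ->]].
  by exists (fun=> 0); rewrite big1 // => k' _; rewrite mul0r.
have [l ->] := gL i; exists (fun k' => b k' + (if k' == l then a i else 0)).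
under [RHS]eq_bigr do rewrite mulrDl; rewrite big_split addrC /=; congr (_ + _).
rewrite (bigD1 l) //= eqxx big1 ?addr0 // => k' /negbTE ->.
by rewrite mul0r.
Qed.

Lemma pihomog_sum d T (s : seq T) (F : T -> {mpoly K[n]}) :
  pihomog mdeg d (\sum_(x <- s) F x) = \sum_(x <- s) pihomog mdeg d (F x).
Proof. exact: raddf_sum. Qed.

(** Linear forms being homogeneous, it is enough to treat the products of one
    of them by a monomial. *)
Lemma forms_ideal_pihomog c d f : forms_ideal c f -> forms_ideal c (pihomog mdeg d f).
Proof.
have [L0 _ LM] := forms_ideal_ideal c.
move=> /forms_idealP [a ->]; rewrite pihomog_sum.
apply: ideal_sum => [|k]; first exact: forms_ideal_ideal.
rewrite (mpolyE (a k)) mulr_suml pihomog_sum.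
apply: ideal_sum => [|mon]; first exact: forms_ideal_ideal.
have hom : ((a k)@_mon *: 'X_[mon]) * linear_form c k \is (mdeg mon + 1).-homog.
  by apply: dhomogM; [rewrite rpredZ // dhomogX | apply: linear_form_dhomog].
have [<- | ne] := eqVneq (mdeg mon + 1)%N d; last by rewrite (pihomog_ne0 ne hom).
by rewrite pihomog_dE //; apply: LM; apply: ideal_gen_sub; exists k.
Qed.

Lemma add_linear_formsP I c f : is_ideal I ->
  add_linear_forms I c f <-> exists h l, [/\ I h, forms_ideal c l & f = h + l].
Proof.
move=> [I0 ID IM]; have [L0 LD LM] := forms_ideal_ideal c.
split=> [[k [a [g [gJ ->]]]] | [h [l [Ih [k [a [g [gL ->]]]] ->]]]].
  elim/big_rec: _ => [|i x _ [h [l [Ih Ll ->]]]]; first by exists 0, 0; rewrite addr0.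
  have [Ig | Lg] := gJ i.
    by exists (a i * g i + h), l; rewrite addrA; split=> //; apply: ID => //; apply: IM.
  exists h, (a i * g i + l); rewrite addrCA; split=> //; apply: LD => //; apply: LM.
  exact: ideal_gen_sub.
have [_ JD _] := ideal_gen_ideal (fun f => I f \/ exists k, f = linear_form c k).
apply: JD; first by apply: ideal_gen_sub; left.
by exists k, a, g; split=> // i; right.
Qed.

End FormsIdeal.

Section RestrictionKernel.
Variables (K : fieldType) (n m : nat) (c : 'M[K]_(m, n.+1)) (p q : 'rV[K]_n.+1).
Hypothesis codim2 : (m + 2 = n.+1)%N.
Hypothesis c_free : row_free c.
Hypotheses (cp : c *m p^T = 0) (cq : c *m q^T = 0).
Hypothesis pq_free : row_free (col_mx p q).
Implicit Types (f g : {mpoly K[n.+1]}) (I J : {mpoly K[n.+1]} -> Prop).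

Lemma restrict_forms0 k : restrict p q (linear_form c k) = 0.
Proof. by rewrite restrict_linear_form cp cq !mxE scale0r addr0. Qed.

(** Coordinates adapted to the line: [lx] and [ly] are dual to [p] and [q], and
    complete the given forms to a basis of the linear forms. *)
Lemma dual_forms : exists lx ly : {mpoly K[n.+1]},
  [/\ lx \is 1.-homog, ly \is 1.-homog, restrict p q lx = 'X, restrict p q ly = 1 &
      forall j, exists b : 'I_m -> K,
        'X_j = p 0 j *: lx + q 0 j *: ly + \sum_k b k *: linear_form c k].
Proof.
pose E := col_mx p q; pose Y := pinvmx E.
have EY : E *m Y = 1%:M by apply: mulmxVp.
have Erow k : row k E *m Y = row k 1%:M by rewrite -row_mul EY.
have pE : row (lshift 1 0) E = p by apply/rowP => j; rewrite mxE col_mxEu.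
have qE : row (rshift 1 0) E = q by apply/rowP => j; rewrite mxE col_mxEd.
exists (linear_form Y^T (lshift 1 0)), (linear_form Y^T (rshift 1 0)).
have val_at v k : (Y^T *m v^T) k 0 = (v *m Y) 0 k by rewrite -trmx_mul mxE.
split; try exact: linear_form_dhomog.
- rewrite restrict_linear_form !val_at -{1}pE -{1}qE !Erow !mxE.
  by rewrite eqxx scale1r eq_sym eq_lrshift addr0.
- rewrite restrict_linear_form !val_at -{1}pE -{1}qE !Erow !mxE.
  by rewrite eq_lrshift scale0r eqxx add0r.
move=> j; pose Z := 1%:M - E^T *m Y^T.
have cE : c *m E^T = 0 by rewrite tr_col_mx mul_mx_row cp cq row_mx0.
have /submxP[B ZB] : (Z <= c)%MS.
  have Zker : (Z <= kermx E^T)%MS.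
    by apply/sub_kermxP; rewrite mulmxBl mul1mx -mulmxA -trmx_mul EY trmx1 mulmx1 subrr.
  apply: (submx_trans Zker); have cker : (c <= kermx E^T)%MS by apply/sub_kermxP.
  rewrite -(geq_leqif (mxrank_leqif_sup cker)) mxrank_ker mxrank_tr.
  by move: c_free pq_free; rewrite /row_free => /eqP -> /eqP ->; rewrite -codim2 addnK.
exists (B j).
rewrite -linear_form_mulmx -ZB -linear_form1.
have -> : (1%:M : 'M[K]_n.+1) = E^T *m Y^T + Z by rewrite addrC subrK.
rewrite linear_formD; congr (_ + _).
rewrite linear_form_mulmx big_split_ord !big_ord1 /=.
by rewrite [E^T _ (lshift _ _)]mxE [E^T _ (rshift _ _)]mxE col_mxEu col_mxEd.
Qed.

Lemma restrict_forms_ideal f : forms_ideal c f -> restrict p q f = 0.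
Proof.
move=> [k [a [g [gL ->]]]]; rewrite rmorph_sum big1 // => i _.
by have [l ->] := gL i; rewrite rmorphM /= restrict_forms0 mulr0.
Qed.

(** Modulo the given forms, a form of degree [d] is a combination of the
    [lx ^+ i * ly ^+ (d - i)], and the coefficients of this combination are
    those of its restriction to the line. *)
Lemma restrict0_forms_ideal d f : f \is d.-homog -> restrict p q f = 0 -> forms_ideal c f.
Proof.
have idJ : is_ideal (forms_ideal c) by apply: ideal_gen_ideal.
have [J0 JD JM] := idJ; set J := forms_ideal c in idJ J0 JD JM *.
have Jc k : J (linear_form c k) by apply: ideal_gen_sub; exists k.
have [lx [ly [_ _ rx ry varE]]] := dual_forms.
(* [hom d u] is the homogenization of [u] in degree [d] *)
pose hom d (u : {poly K}) := \sum_(i < d.+1) u`_i *: (lx ^+ i * ly ^+ (d - i)).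
have homD e (u v : {poly K}) : hom e (u + v) = hom e u + hom e v.
  by rewrite -big_split; apply: eq_bigr => i _; rewrite coefD scalerDl.
have homZ e a (u : {poly K}) : hom e (a *: u) = a *: hom e u.
  by rewrite scaler_sumr; apply: eq_bigr => i _; rewrite coefZ scalerA.
have homX e (u : {poly K}) : hom e.+1 ('X * u) = lx * hom e u.
  rewrite /hom big_ord_recl coefXM scale0r add0r mulr_sumr; apply: eq_bigr => i _.
  by rewrite coefXM /= subSS exprS -scalerAr mulrA.
have hom1 e (u : {poly K}) : (size u <= e.+1)%N -> hom e.+1 u = ly * hom e u.
  move=> su; rewrite /hom big_ord_recr /= nth_default // scale0r addr0 mulr_sumr.
  apply: eq_bigr => i _; rewrite -scalerAr mulrCA -exprS subSn //.
  by rewrite -ltnS.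
(* [approx e g]: modulo the forms, [g] is a binary form of degree [e] *)
pose approx e g := exists2 u : {poly K}, (size u <= e.+1)%N & J (g - hom e u).
have approx_sum e (T : Type) (s : seq T) (F : T -> {mpoly K[n.+1]}) :
    (forall i, approx e (F i)) -> approx e (\sum_(i <- s) F i).
  move=> aF; elim/big_rec: _ => [|i g _ [u su Ju]].
    exists 0; rewrite ?size_poly0 // /hom big1 ?subr0 // => i _.
    by rewrite coef0 scale0r.
  have [v sv Jv] := aF i; exists (v + u).
    by rewrite (leq_trans (size_polyD _ _)) // geq_max sv.
  by rewrite homD opprD addrACA; apply: JD.
have approxZ e a g : approx e g -> approx e (a *: g).
  move=> [u su Ju]; exists (a *: u); first exact: leq_trans (size_scale_leq _ _) su.
  by rewrite homZ -scalerBr -mul_mpolyC; apply: JM.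
have approxX e j g : approx e g -> approx e.+1 ('X_j * g).
  move=> [u su Ju]; exists (p 0 j *: ('X * u) + q 0 j *: u).
    rewrite (leq_trans (size_polyD _ _)) // geq_max !(leq_trans (size_scale_leq _ _)) //.
      by rewrite (leq_trans su).
    by rewrite (leq_trans (size_polyMleq _ _)) // size_polyX.
  have [b Eb] := varE j; rewrite homD !homZ homX hom1 //.
  have -> : 'X_j * g - (p 0 j *: (lx * hom e u) + q 0 j *: (ly * hom e u)) =
     'X_j * (g - hom e u) + hom e u * \sum_k b k *: linear_form c k.
    rewrite mulrBr -addrA; congr (_ + _); rewrite Eb [hom e u * _]mulrC !mulrDl -!scalerAl.
    by rewrite !opprD -!addrA addNr addr0.
  apply: (JD); first exact: (JM).
  by apply: (JM); apply: ideal_sum => // k; rewrite -mul_mpolyC; apply: (JM).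
have approx_mon (mm : 'X_{1..n.+1}) : approx (mdeg mm) 'X_[mm].
  rewrite mpolyXE_id mdegE; apply: (big_rec2 (fun e g => approx e g)) => [|j e g _ IH].
    exists 1; first by rewrite size_poly1.
    by rewrite /hom big_ord1 coef1 subn0 !expr0 mulr1 scale1r subrr.
  elim: (mm j) => [|k IHk]; first by rewrite mul1r.
  by rewrite exprS -mulrA; apply: approxX.
move=> /dhomogP fd f0.
have [u su Ju] : approx d f.
  rewrite (mpolyE f) big_seq; elim/big_rec: _ => [|mm g mf ag].
    by have := approx_sum d void [::] (fun=> 0) (fun i => match i with end); rewrite big_nil.
  have := approx_sum d bool [:: true; false] (fun b => if b then f@_mm *: 'X_[mm] else g).
  rewrite big_cons big_seq1; apply => -[] //; apply: approxZ.
  by rewrite -(fd _ mf); apply: approx_mon.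
suff u0 : u = 0.
  by move: Ju; rewrite u0 /hom big1 ?subr0 // => i _; rewrite coef0 scale0r.
have := restrict_forms_ideal Ju; rewrite rmorphB /= f0 sub0r => /eqP; rewrite oppr_eq0 => /eqP <-.
rewrite rmorph_sum -{1}(coefK u) poly_def.
rewrite (big_ord_widen _ (fun i => u`_i *: 'X^i) su) big_mkcond.
apply: eq_bigr => i _; rewrite /= restrictZ rmorphM !rmorphXn /= rx ry expr1n mulr1.
by case: ltnP => // le; rewrite nth_default ?scale0r.
Qed.

(** Adding the linear forms to the ideal does not change the restrictions.  The
    element of [I] has to be cut down to degree [d] because generators of other
    degrees may occur. *)
Lemma restrict_add_forms I d f : is_homogeneous_ideal I ->
  add_linear_forms I c f -> f \is d.-homog ->
  exists h, [/\ I h, h \is d.-homog & restrict p q h = restrict p q f].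
Proof.
move=> [idI homI] /(add_linear_formsP _ _ idI) [h [l [Ih Ll Ef]]] fd.
exists (pihomog mdeg d h); split; [exact: homI | exact: pihomogP |].
rewrite -(pihomog_dE fd) Ef pihomogD rmorphD /=.
by rewrite (restrict_forms_ideal (forms_ideal_pihomog d Ll)) addr0.
Qed.

Definition restrict_form d (f : dhomog n.+1 K d) : 'rV[K]_d.+1 := poly_rV (restrict p q (val f)).

Fact restrict_form_is_linear d : linear (@restrict_form d).
Proof. by move=> a f g; rewrite /restrict_form linearP rmorphD /= restrictZ linearP. Qed.

HB.instance Definition _ d := GRing.isLinear.Build K (dhomog n.+1 K d) 'rV[K]_d.+1 _
  (@restrict_form d) (@restrict_form_is_linear d).

Definition restricted_piece J d : {vspace 'rV[K]_d.+1} :=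
  (linfun (@restrict_form d) @: graded_piece J d)%VS.

Lemma restricted_pieceP I d v : is_homogeneous_ideal I ->
  reflect (exists2 h, I h /\ h \is d.-homog & v = poly_rV (restrict p q h))
          (v \in restricted_piece (add_linear_forms I c) d).
Proof.
move=> homI; pose J := add_linear_forms I c.
have gpP : is_graded_piece J (graded_piece J d) by apply/graded_pieceP/ideal_gen_ideal.
apply: (iffP memv_imgP) => [[f /gpP Jf ->] | [h [Ih hd] ->]].
  have [h [Ih hd Eh]] := restrict_add_forms homI Jf (dhomog_is_dhomog f).
  by exists h; rewrite ?lfunE /= /restrict_form ?Eh.
exists (DHomog hd); last by rewrite lfunE.
by apply/gpP/ideal_gen_sub; left.
Qed.

(** Restriction maps the forms of degree [d] onto the polynomials of degree at
    most [d], and its kernel lies in the ideal, since the linear forms do. *)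
Lemma quotient_dim_restricted I d :
  (quotient_dim (add_linear_forms I c) d +
   \dim (restricted_piece (add_linear_forms I c) d) = d.+1)%N.
Proof.
set J := add_linear_forms I c.
have gpP : is_graded_piece J (graded_piece J d) by apply/graded_pieceP/ideal_gen_ideal.
set phi := linfun (@restrict_form d).
have ker_sub : (lker phi <= graded_piece J d)%VS.
  apply/subvP => f; rewrite memv_ker lfunE /= => /eqP /(congr1 rVpoly).
  rewrite poly_rV_K ?size_restrict_dhomog ?dhomog_is_dhomog // linear0 => f0.
  apply/gpP; have [k [a [g [gL ->]]]] := restrict0_forms_ideal (dhomog_is_dhomog f) f0.
  by exists k, a, g; split=> // i; right.
have img : (phi @: fullv)%VS = fullv.
  have [lx [ly [lxd lyd rx ry _]]] := dual_forms.
  apply/vspaceP => v; rewrite memvf; apply/memv_imgP.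
  pose F i : {mpoly K[n.+1]} := lx ^+ i * ly ^+ (d - i).
  have Fd (i : 'I_d.+1) : F i \is d.-homog.
    have : F i \is (1 * i + 1 * (d - i))%N.-homog by apply: dhomogM; apply: dhomogMn.
    by rewrite !mul1n subnKC // -ltnS.
  have hd : \sum_(i < d.+1) v 0 i *: F i \is d.-homog.
    by rewrite rpred_sum // => i _; rewrite rpredZ.
  exists (DHomog hd); rewrite ?memvf // lfunE /= /restrict_form /= rmorph_sum.
  apply/rowP => j; rewrite mxE coef_sum (bigD1 j) //= restrictZ rmorphM !rmorphXn /= rx ry.
  rewrite expr1n mulr1 coefZ coefXn eqxx mulr1 big1 ?addr0 // => i ij.
  rewrite restrictZ rmorphM !rmorphXn /= rx ry expr1n mulr1 coefZ coefXn.
  by rewrite eq_sym -val_eqE in ij; rewrite (negbTE ij) mulr0.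
have := limg_ker_dim phi fullv; have := limg_ker_dim phi (graded_piece J d).
rewrite img -/(restricted_piece J d) capfv (capv_idPr ker_sub).
rewrite [\dim {: 'rV_ _}]dimvf dim_matrix mul1r.
have := dimvS (subvf (graded_piece J d)).
rewrite /quotient_dim -/J => le E1 E2; move: le; rewrite -E2 -E1 leq_add2l => le.
by rewrite subnDl subnK.
Qed.

End RestrictionKernel.

(** * Moving a line while keeping polynomial conditions *)

Section Nonvanishing.
Variable K : fieldType.
Hypothesis charK : [pchar K] =i pred0.

Lemma poly_nonroot (u : {poly K}) : u != 0 -> exists x, u.[x] != 0.
Proof.
move=> u0; pose rs := [seq k%:R : K | k <- iota 0 (size u)].
have rs_uniq : uniq rs.
  have inj : injective (fun k : nat => k%:R : K).
    have le_inj k l : (k <= l)%N -> k%:R = l%:R :> K -> k = l.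
      move=> kl /eqP; rewrite eq_sym -subr_eq0 -natrB // ((pcharf0P _).1 charK).
      by rewrite subn_eq0 => lk; apply/eqP; rewrite eqn_leq kl.
    move=> k l E; have [kl | /ltnW lk] := leqP k l; first exact: le_inj.
    by apply/esym/le_inj.
  by rewrite map_inj_uniq ?iota_uniq.
have : ~~ all (root u) rs.
  apply/negP => /(max_poly_roots u0) /(_ rs_uniq).
  by rewrite size_map size_iota ltnn.
by case/allPn => x _ ux; exists x.
Qed.

(** Induction on [n]: first keep the leading coefficient in one variable
    nonzero, then choose the value of that variable. *)
Lemma mpoly_nonroot n (F : {mpoly K[n]}) : F != 0 -> exists v : 'rV[K]_n, F.@[v 0] != 0.
Proof.
suff H : F != 0 -> exists v : 'I_n -> K, F.@[v] != 0.
  move=> /H [v Fv]; exists (\row_i v i).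
  by rewrite (@meval_eq _ _ _ v) // => i; rewrite mxE.
elim: n F => [|n IH] F F0.
  exists (fun=> 0); have EF : F = (F@_0)%:MP.
    by apply: msize1_polyC; rewrite msizeE; apply/bigmax_leqP_seq => m _ _; rewrite mdegE big_ord0.
  by rewrite EF mevalC; apply: contra_neq F0 => E; rewrite EF E mpolyC0.
have F0' : mpoly_to_poly F != 0.
  by rewrite -(rmorph0 (@mpoly_to_poly K n)) (can_eq (@mpoly_to_polyK K n)).
have [v lv] : exists v, (lead_coef (mpoly_to_poly F)).@[v] != 0.
  by apply: IH; rewrite lead_coef_eq0.
have [x Fx] : exists x, (map_poly (meval v) (mpoly_to_poly F)).[x] != 0.
  apply: poly_nonroot; apply: contra_neq lv => F0''.
  by rewrite lead_coefE -coef_map F0'' coef0.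
exists (fun i => if unlift ord0 i is Some j then v j else x).
suff -> : forall G : {mpoly K[n.+1]}, G.@[fun i => if unlift ord0 i is Some j then v j else x] =
   (map_poly (meval v) (mpoly_to_poly G)).[x] by [].
apply: (@mpoly_rmorph_eq n.+1 K _ (meval (fun i => if unlift ord0 i is Some j then v j else x))
   (horner_eval x \o map_poly (meval v) \o @mpoly_to_poly K n)) => [a|i] /=.
  by rewrite mevalC mpoly_to_polyC map_polyC /= /horner_eval hornerC mevalC.
rewrite mevalXU; case: (unliftP ord0 i) => [j|] ->.
  by rewrite mpoly_to_polyXS map_polyC /= /horner_eval hornerC mevalXU.
by rewrite mpoly_to_polyX0 map_polyX /= /horner_eval hornerX.
Qed.

(** Nonempty open conditions on the points of a space and on a linear family
    parametrized by that space can be met at once. *)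
Lemma nonroot_linear_family N m l (phi : {linear 'rV[K]_N -> 'M[K]_(m, l)})
    (F : {mpoly K[m * l]}) (H : {mpoly K[N]}) w :
  F.@[mxvec (phi w) 0] != 0 -> H != 0 ->
  exists2 q : 'rV[K]_N, F.@[mxvec (phi q) 0] != 0 & H.@[q 0] != 0.
Proof.
move=> Fw H0.
(* the coordinates of [phi q], as polynomials in [q] *)
pose ev k : {mpoly K[N]} := \sum_j (mxvec (phi (delta_mx 0 j)) 0 k) *: 'X_j.
have evE (q : 'rV[K]_N) k : (ev k).@[q 0] = mxvec (phi q) 0 k.
  rewrite [RHS](congr1 (fun v => mxvec (phi v) 0 k) (row_sum_delta q)) /ev rmorph_sum /=.
  rewrite !linear_sum summxE.
  by apply: eq_bigr => j _; rewrite mevalZ mevalXU !linearZ mulrC [RHS]mxE.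
pose G := F \mPo [tuple ev k | k < m * l].
have GE (q : 'rV[K]_N) : G.@[q 0] = F.@[mxvec (phi q) 0].
  by rewrite comp_mpoly_meval; apply: meval_eq => k; rewrite tnth_mktuple evE.
have G0 : G != 0 by apply: contraNneq Fw => G0; rewrite -GE G0 meval0.
have [q] := mpoly_nonroot (mulf_neq0 G0 H0).
by rewrite mevalM mulf_eq0 negb_or GE => /andP[]; exists q.
Qed.

(** Moves a system of linear forms [c] vanishing at [p] to one vanishing at a
    further point [q] that avoids the roots of [H].  With [w] another point
    where [c] vanishes, and [ell] a linear form with [ell p = 0] and
    [ell w = 1], the forms [v |-> ell q * c v - ell v * c q] vanish at [p] and
    [q], depend linearly on [q], and are the original ones for [q = w].  The
    case [p = 0] is used to choose a first point. *)
Lemma line_step m n (F : {mpoly K[m * n]}) (H : {mpoly K[n]}) (c : 'M[K]_(m, n)) (p : 'rV[K]_n) :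
  (m + 2 <= n)%N -> F.@[mxvec c 0] != 0 -> H != 0 -> c *m p^T = 0 ->
  exists (q : 'rV[K]_n) (c' : 'M[K]_(m, n)),
    [/\ F.@[mxvec c' 0] != 0, H.@[q 0] != 0, c' *m p^T = 0, c' *m q^T = 0 &
        ~~ (q <= p)%MS].
Proof.
move=> mn Fc H0 cp.
(* [c] has corank at least 2, so its kernel is not contained in the span of [p] *)
have [w cw wp] : exists2 w : 'rV_n, c *m w^T = 0 & ~~ (w <= p)%MS.
  have /row_subPn [i wp] : ~~ (kermx c^T <= p)%MS.
    apply: contraL mn => /mxrankS; rewrite mxrank_ker mxrank_tr.
    by have := rank_leq_row c; have := rank_leq_row p; lia.
  exists (row i (kermx c^T)) => //.
  by apply: trmx_inj; rewrite trmx_mul trmxK -row_mul mulmx_ker row0 trmx0.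
have [z pz wz] : exists2 z : 'cV_n, p *m z = 0 & (w *m z) 0 0 != 0.
  have [j wj] : exists j, (w *m cokermx p) 0 j != 0.
    by apply/rV0Pn; rewrite -submxE.
  exists (cokermx p *m delta_mx j 0); first by rewrite (mulmxA p) mulmx_coker mul0mx.
  by rewrite (mulmxA w) -colE mxE.
have [ell pell well] : exists2 ell : 'cV_n, p *m ell = 0 & w *m ell = 1%:M.
  exists (((w *m z) 0 0)^-1 *: z); first by rewrite -scalemxAr pz scaler0.
  by rewrite -scalemxAr {2}[w *m z]mx11_scalar -[RHS]scalemx1 -scalemx1 scalerA mulVf.
pose phi (q : 'rV[K]_n) : 'M[K]_(m, n) := (q *m ell) 0 0 *: c - (c *m q^T) *m ell^T.
have phi_lin : linear phi.
  move=> a u v; rewrite /phi mulmxDl -scalemxAl !mxE.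
  rewrite [(_ + _)^T]linearD /= [(_ *: _)^T]linearZ /=.
  rewrite mulmxDr -scalemxAr mulmxDl -scalemxAl.
  by rewrite scalerDl scalerBr scalerA opprD addrACA.
pose phiL : {linear 'rV[K]_n -> 'M[K]_(m, n)} :=
  HB.pack phi (GRing.isLinear.Build _ _ _ _ phi phi_lin).
have phi_w : phiL w = c by rewrite /= /phi well cw mul0mx subr0 mxE eqxx scale1r.
(* requiring that [ell q] be nonzero keeps [q] out of the span of [p] *)
pose L : {mpoly K[n]} := \sum_j ell j 0 *: 'X_j.
have LE (q : 'rV[K]_n) : L.@[q 0] = (q *m ell) 0 0.
  rewrite mxE /L rmorph_sum /=.
  by apply: eq_bigr => j _; rewrite mevalZ mevalXU mulrC.
have L0 : L != 0.
  have: L.@[w 0] != 0 by rewrite LE well mxE oner_neq0.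
  by apply: contraNneq => ->; rewrite meval0.
have Fw : F.@[mxvec (phiL w) 0] != 0 by rewrite phi_w.
have [q Fq] := nonroot_linear_family Fw (mulf_neq0 H0 L0).
rewrite mevalM mulf_eq0 negb_or LE => /andP[Hq qell].
have ellT (v : 'rV[K]_n) : ell^T *m v^T = ((v *m ell) 0 0)%:M.
  by rewrite -trmx_mul [v *m ell]mx11_scalar tr_scalar_mx !mxE eqxx mulr1n.
exists q, (phi q); split=> //.
- rewrite /phi mulmxBl -scalemxAl cp scaler0 sub0r -(mulmxA _ ell^T) ellT pell mxE.
  by rewrite -scalemx1 scale0r mulmx0 oppr0.
- by rewrite /phi mulmxBl -scalemxAl -(mulmxA _ ell^T) ellT mul_mx_scalar subrr.
apply: contra qell => /submxP[a ->].
by rewrite -mulmxA pell mulmx0 mxE.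
Qed.

End Nonvanishing.

(** * Existence of the generic values *)

(** Lower semicontinuity of the rank: with a right inverse [N] of the matrix at
    [c0], the polynomial is the determinant of the product by [N]. *)
Lemma row_free_open (K : fieldType) m n r s (B0 : 'M[K]_(r, s))
    (phi : {linear 'M[K]_(m, n) -> 'M[K]_(r, s)}) c0 :
  row_free (B0 + phi c0) ->
  exists2 F : {mpoly K[m * n]}, F.@[mxvec c0 0] != 0 &
    forall c, F.@[mxvec c 0] != 0 -> row_free (B0 + phi c).
Proof.
move=> free0; pose N := pinvmx (B0 + phi c0).
pose B : 'M[{mpoly K[m * n]}]_(r, s) := \matrix_(i, j) ((B0 i j)%:MP +
  \sum_k (phi (vec_mx (delta_mx 0 k)) i j) *: 'X_k).
have BE c : map_mx (meval (mxvec c 0)) B = B0 + phi c.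
  apply/matrixP => i j; rewrite !mxE mevalD mevalC rmorph_sum; congr (_ + _).
  have -> : phi c i j = phi (vec_mx (\sum_k mxvec c 0 k *: delta_mx 0 k)) i j.
    by rewrite -row_sum_delta mxvecK.
  rewrite !linear_sum summxE.
  by apply: eq_bigr => k _; rewrite /= mevalZ mevalXU !linearZ /= mulrC [RHS]mxE.
have FE c1 : (\det (B *m map_mx (@mpolyC _ K) N)).@[mxvec c1 0] = \det ((B0 + phi c1) *m N).
  rewrite -det_map_mx map_mxM BE -map_mx_comp; congr (\det (_ *m _)).
  by apply/matrixP => i j; rewrite mxE /= mevalC.
exists (\det (B *m map_mx (@mpolyC _ K) N)).
  by rewrite FE mulmxVp // det1 oner_neq0.
move=> c; rewrite FE -unitfE -unitmxE => /mxrank_unit rk.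
by rewrite /row_free eqn_leq rank_leq_row /=; apply: leq_trans (mxrankM_maxl _ N); rewrite rk.
Qed.

Lemma row_free_open_id (K : fieldType) m n : (m <= n)%N ->
  exists2 F : {mpoly K[m * n]}, F != 0 &
    forall c : 'M_(m, n), F.@[mxvec c 0] != 0 -> row_free c.
Proof.
move=> mn.
have [|F F0 FP] := @row_free_open K m n m n 0 idfun (pid_mx m).
  by rewrite add0r /= /row_free rank_pid_mx ?eqxx.
exists F; first by apply: contraNneq F0 => ->; rewrite meval0.
by move=> c /FP; rewrite add0r.
Qed.

Lemma exists_max (T : Type) (f : T -> nat) b (x0 : T) :
  (forall x, (f x <= b)%N) -> exists x, forall y, (f y <= f x)%N.
Proof.
move=> fb; have [k] := ubnP (b - f x0); elim: k x0 => // k IH x0 kb.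
have [[y yx] | no] := classic (exists y, (f x0 < f y)%N).
  by apply: (IH y); have := fb y; lia.
by exists x0 => y; rewrite leqNgt; apply/negP => yx; apply: no; exists y.
Qed.

Import VectorInternalTheory.

Section GenericValue.
Variables (K : fieldType) (n : nat) (I : {mpoly K[n.+1]} -> Prop).
Hypothesis homI : is_homogeneous_ideal I.

(** An element of the ideal generated by [I] and the forms of [c0] extends to an
    affine family of elements, obtained by replacing [c0] with a variable [c]
    in an expression of it by generators. *)
Lemma graded_piece_lift m d (c0 : 'M[K]_(m, n.+1)) (f : dhomog n.+1 K d) :
  f \in graded_piece (add_linear_forms I c0) d ->
  exists (B0 : dhomog n.+1 K d) (phi : {linear 'M[K]_(m, n.+1) -> dhomog n.+1 K d}),
    f = B0 + phi c0 /\ forall c, B0 + phi c \in graded_piece (add_linear_forms I c) d.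
Proof.
have gpP c : is_graded_piece (add_linear_forms I c) (graded_piece (add_linear_forms I c) d).
  by apply/graded_pieceP/ideal_gen_ideal.
have [idI homI'] := homI.
move=> /gpP /(add_linear_formsP _ _ idI) [h [l [Ih /forms_idealP [a Ea] Ef]]].
pose phi (c : 'M[K]_(m, n.+1)) : dhomog n.+1 K d :=
  DHomog (pihomogP mdeg d (\sum_k a k * linear_form c k)).
have phi_lin : linear phi.
  move=> x u v; apply: val_inj; rewrite /= -linearP; congr (pihomog _ _ _).
  rewrite scaler_sumr -big_split; apply: eq_bigr => k _ /=.
  rewrite linear_formD mulrDr scalerAr; congr (_ * _ + _).
  rewrite /linear_form scaler_sumr; apply: eq_bigr => j _.
  by rewrite mxE scalerA.
pose phiL : {linear 'M[K]_(m, n.+1) -> dhomog n.+1 K d} :=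
  HB.pack phi (GRing.isLinear.Build _ _ _ _ phi phi_lin).
exists (DHomog (pihomogP mdeg d h)), phiL.
split.
  apply: val_inj; rewrite /= -[LHS](pihomog_dE (dhomog_is_dhomog f)) /= Ef Ea.
  exact: pihomogD.
move=> c; apply/gpP/add_linear_formsP => //.
exists (pihomog mdeg d h), (pihomog mdeg d (\sum_k a k * linear_form c k)).
by split; [apply: homI' | apply/forms_ideal_pihomog/forms_ideal_sum |].
Qed.

(** The dimension of the graded piece takes its greatest value at some [c0].  A
    basis there extends to families of elements that stay independent on a
    Zariski-open set, where the dimension is therefore the greatest one. *)
Lemma generic_value_exists i d : exists r, is_generic_value I i d r.
Proof.
pose J (c : 'M[K]_(n.+1 - i, n.+1)) := add_linear_forms I c.
have [c0 c0max] : exists c0, forall c,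
    (\dim (graded_piece (J c) d) <= \dim (graded_piece (J c0) d))%N.
  apply: (@exists_max _ _ (\dim (fullv : {vspace dhomog n.+1 K d})) 0) => c.
  exact/dimvS/subvf.
set W0 := graded_piece (J c0) d in c0max.
pose r := \dim W0.
have lift (k : 'I_r) : exists bphi : dhomog n.+1 K d *
    {linear 'M[K]_(n.+1 - i, n.+1) -> dhomog n.+1 K d},
    (vbasis W0)`_k = bphi.1 + bphi.2 c0 /\
    forall c, bphi.1 + bphi.2 c \in graded_piece (J c) d.
  have [|b [phi P]] := @graded_piece_lift _ d c0 (vbasis W0)`_k.
    by apply/vbasis_mem/mem_nth; rewrite size_tuple.
  by exists (b, phi).
have [bphi bphiP] : exists bphi : 'I_r -> dhomog n.+1 K d *
    {linear 'M[K]_(n.+1 - i, n.+1) -> dhomog n.+1 K d}, forall k : 'I_r,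
   (vbasis W0)`_k = (bphi k).1 + (bphi k).2 c0 /\
    forall c, (bphi k).1 + (bphi k).2 c \in graded_piece (J c) d.
  exists (fun k => proj1_sig (constructive_indefinite_description _ (lift k))) => k.
  exact: proj2_sig (constructive_indefinite_description _ (lift k)).
pose B0 : 'M[K]_(r, dim (dhomog n.+1 K d)) := \matrix_k v2r (bphi k).1.
pose Phi (c : 'M[K]_(n.+1 - i, n.+1)) : 'M[K]_(r, dim (dhomog n.+1 K d)) :=
  \matrix_k v2r ((bphi k).2 c).
have Phi_lin : linear Phi.
  by move=> x u v; apply/matrixP => s t; rewrite !mxE !linearP !mxE.
pose PhiL : {linear 'M[K]_(n.+1 - i, n.+1) -> 'M[K]_(r, dim (dhomog n.+1 K d))} :=
   HB.pack Phi (GRing.isLinear.Build _ _ _ _ Phi Phi_lin).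
have rowE c (u : 'rV_r) : u *m (B0 + PhiL c) =
    v2r (\sum_(k < r) u 0 k *: ((bphi k).1 + (bphi k).2 c)).
  rewrite mulmx_sum_row linear_sum; apply: eq_bigr => k _.
  rewrite [RHS]linearZ; congr (_ *: _); rewrite [RHS]linearD.
  by apply/rowP => t; rewrite !mxE.
have free0 : row_free (B0 + PhiL c0).
  apply: inj_row_free => u; rewrite rowE => E.
  have u0 : \sum_(k < r) u 0 k *: ((bphi k).1 + (bphi k).2 c0) = 0.
    by apply: v2r_inj; rewrite E linear0.
  have /freeP := basis_free (vbasisP W0) => /(_ (fun k => u 0 k)) fr.
  apply/rowP => k; rewrite mxE; apply: fr; rewrite -[RHS]u0.
  by apply: eq_bigr => k' _; rewrite (bphiP k').1.
have [F F0 FP] := row_free_open free0.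
exists (quotient_dim (J c0) d), (fun c => exists2 G, G = F & G.@[mxvec c 0] != 0); split.
- by exists (fun G => G = F) => c; split.
- by exists c0, F.
move=> c [_ -> /FP freec]; rewrite /quotient_dim; congr (_ - _)%N.
apply/eqP; rewrite eqn_leq c0max /=.
pose X := [tuple (bphi k).1 + (bphi k).2 c | k < r].
have freeX : free X.
  apply/freeP => u u0 k.
  have /rowP/(_ k) : \row_k u k = 0.
    apply: (row_free_inj freec); rewrite mul0mx rowE [X in v2r X](_ : _ = 0) ?linear0 //.
    rewrite -[RHS]u0; apply: eq_bigr => k' _.
    by rewrite mxE -[X`_k']tnth_nth tnth_mktuple.
  by rewrite !mxE.
have -> : \dim (graded_piece (J c0) d) = \dim <<X>>%VS.
  by move: freeX; rewrite /free size_tuple => /eqP ->.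
apply/dimvS/span_subvP => _ /tnthP[k ->]; rewrite tnth_mktuple.
exact: (bphiP k).2.
Qed.

(** All that is used of the sectional matrix: its value is attained off the
    roots of a nonzero polynomial. *)
Lemma sectional_matrix_generic i d :
  exists2 F : {mpoly K[(n.+1 - i) * n.+1]}, F != 0 &
    forall c, F.@[mxvec c 0] != 0 ->
      quotient_dim (add_linear_forms I c) d = sectional_matrix I i d.
Proof.
have [U [[S US] [c Uc] qU]] : is_generic_value I i d (sectional_matrix I i d).
  by apply: epsilon_spec; apply: generic_value_exists.
have [F SF Fc] := (US c).1 Uc.
exists F; first by apply: contraNneq Fc => ->; rewrite meval0.
by move=> c' Fc'; apply/qU/US; exists F.
Qed.

End GenericValue.

(** * From one degree to a truncated ideal *)

Section TruncatedGcd.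
Variables (K : fieldType) (n : nat).
Implicit Types (f g h G : {mpoly K[n]}).

Lemma divides_msize1 g h : divides g h -> h != 0 -> msize g = msize h -> divides h g.
Proof.
move=> [u Eh] h0 gh; move: h0; rewrite Eh mulf_eq0 negb_or => /andP[u0 g0].
have [c c0 Eu] : exists2 c, c != 0 & u = c%:MP.
  apply/msize_poly1P; move: gh; rewrite Eh msizeM //.
  by move: u0 g0; rewrite -!msize_poly_eq0; move: (msize u) (msize g) => a b; lia.
by exists (c^-1)%:MP; rewrite Eu mulrA -mpolyCM mulVf // mpolyC1 mul1r.
Qed.

Lemma gcd_variables (i j : 'I_n) : i != j -> gcd_of ('X_i : {mpoly K[n]}) 'X_j 1.
Proof.
move=> ij; split; try by eexists; rewrite mulr1.
move=> h [u Eu] [v Ev].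
have X0 : ('X_i : {mpoly K[n]}) != 0 by rewrite -msize_poly_eq0 msizeX mdeg1.
have [u0 h0] : u != 0 /\ h != 0 by move: X0; rewrite Eu mulf_eq0 negb_or => /andP.
have : msize ('X_i : {mpoly K[n]}) = 2%N by rewrite msizeX mdeg1.
rewrite Eu msizeM // => suh.
have [sh | su] : msize h = 1%N \/ msize u = 1%N.
  by move: suh u0 h0; rewrite -!msize_poly_eq0; move: (msize u) (msize h) => a b; lia.
  have /eqP/msize_poly1P [c c0 Eh] := sh.
  by exists (c^-1)%:MP; rewrite Eh -mpolyCM mulVf // mpolyC1.
have /eqP/msize_poly1P [c c0 Ec] := su.
pose e k : K := (k == j)%:R.
have := congr1 (meval e) Ev; have := congr1 (meval e) Eu.
rewrite !mevalM !mevalXU /e eqxx (negbTE ij) Ec mevalC => /esym/eqP.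
by rewrite mulf_eq0 (negbTE c0) /= => /eqP ->; rewrite mulr0 => /eqP; rewrite oner_eq0.
Qed.

Lemma divides_mul_variables (i j : 'I_n) G f : i != j ->
  divides G ('X_i * f) -> divides G ('X_j * f) -> divides G f.
Proof.
move=> /gcd_variables /(gcd_of_mull (@mpoly_gcd_domain K n) f) [_ _ fmax].
by rewrite ![_ * f]mulrC => /fmax H /H; rewrite mulr1.
Qed.

(** A divisor of all forms of degree [d] divides those of lower degree, since it
    divides their products by two distinct, hence coprime, variables. *)
Lemma is_gcd_truncated (I : {mpoly K[n]} -> Prop) d G (i j : 'I_n) :
  i != j -> is_ideal I ->
  (forall f, I f -> f \is d.-homog -> divides G f) ->
  (forall h, (forall f, I f -> f \is d.-homog -> divides h f) -> divides h G) ->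
  is_gcd (truncated_ideal I d) G.
Proof.
move=> ij [I0 ID IM] Gd Gmax.
have low k e f : (e + k = d)%N -> I f -> f \is e.-homog -> divides G f.
  elim: k e f => [|k IH] e f; first by rewrite addn0 => ->; apply: Gd.
  move=> ekd If fe; have GX l : divides G ('X_l * f).
    apply: (IH e.+1); [by rewrite addSnnS | exact: IM |].
    by rewrite -add1n dhomogM // dhomogX /= mdeg1.
  exact: (divides_mul_variables ij).
split=> [_ [k [a [g [gI ->]]]] | h hI].
  apply: divides_sum => l; apply: divides_mull.
  have [Ig [e ed ge]] := gI l.
  by apply: (low (d - e)%N e); rewrite ?subnKC.
by apply: Gmax => f If fd; apply: hI; apply: ideal_gen_sub; split=> //; exists d.
Qed.

End TruncatedGcd.

(** The finite list [fs] is a basis of the forms of degree [d]; it lets the gcd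
    be taken, and Bezout identities be written, over finitely many forms. *)
Lemma graded_piece_gcd (K : fieldType) n (I : {mpoly K[n.+1]} -> Prop) d f0 :
  is_ideal I -> I f0 -> f0 \is d.-homog -> f0 != 0 ->
  exists (G : {mpoly K[n.+1]}) (fs : seq {mpoly K[n.+1]}),
    [/\ forall f, I f -> f \is d.-homog -> divides G f,
        forall f, f \in fs -> I f /\ f \is d.-homog,
        exists2 f, f \in fs & f != 0 &
        forall h, (forall f, f \in fs -> divides h f) -> divides h G].
Proof.
move=> idI If0 f0d f00; have gpP : is_graded_piece I (graded_piece I d) by apply: graded_pieceP.
set W := graded_piece I d in gpP; pose fs := [seq val f | f <- vbasis W].
have [G [Gfs Gmax]] := list_gcd fs (@mpoly_gcd_domain K n.+1).
have GI f : I f -> f \is d.-homog -> divides G f.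
  move=> If fd; have /gpP fW : I (val (DHomog fd)) by [].
  have -> : f = \sum_i coord (vbasis W) i (DHomog fd) *: val (vbasis W)`_i.
    rewrite -[LHS]/(mpoly_of_dhomog (DHomog fd)) {1}(coord_vbasis fW) linear_sum.
    by apply: eq_bigr => i _; rewrite linearZ.
  apply: divides_sum => i; rewrite -mul_mpolyC; apply/divides_mull/Gfs/map_f.
  by rewrite mem_nth // size_tuple.
exists G, fs; split=> //.
  move=> _ /mapP[f fW ->]; split; last exact: dhomog_is_dhomog.
  by apply/gpP/vbasis_mem.
have [/hasP[f ffs fn0] | /hasPn fs0] := boolP (has (fun f => f != 0) fs); first by exists f.
have [q Eq] : divides 0 G.
  by apply: Gmax => f /fs0 /negPn /eqP ->; apply: divides0.
have [u Eu] := GI _ If0 f0d.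
by move: f00; rewrite Eu Eq !mulr0 eqxx.
Qed.

(** * The theorem *)

Lemma divides_size (K : fieldType) (u v : {poly K}) :
  divides u v -> divides v u -> size u = size v.
Proof.
have le (a b : {poly K}) : b != 0 -> divides a b -> (size a <= size b)%N.
  by move=> b0 [q Eq]; apply: dvdp_leq => //; rewrite Eq dvdp_mull.
move=> uv vu; have [u0 | u0] := eqVneq u 0.
  by move: uv; rewrite u0 => -[q ->]; rewrite mulr0.
have v0 : v != 0 by apply: contra_neq u0 => v0; case: vu => q ->; rewrite v0 mulr0.
by apply/eqP; rewrite eqn_leq !le.
Qed.

(** Restriction never raises the degree, and the degrees of [G] and of its
    cofactor add up to [d], which is the degree of the restriction of [f]. *)
Lemma size_restrict_divisor (K : fieldType) n (p q : 'rV[K]_n) d (G f : {mpoly K[n]}) :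
  f \is d.-homog -> f.@[p 0] != 0 -> divides G f ->
  size (restrict p q G) = msize G.
Proof.
move=> fd fp [h Eh].
have f0 : f != 0 by apply: contraNneq fp => ->; rewrite meval0.
have := size_restrict_eq q fd fp; have := f0; rewrite Eh mulf_eq0 negb_or => /andP[h0 G0].
have := dhomog_msize fd; rewrite Eh rmorphM /=.
have := size_restrict p q h; have := size_restrict p q G.
move=> sG sh fd' E.
have := size_polyMleq (restrict p q h) (restrict p q G); rewrite E => le.
have : msize (h * G) = d.+1.
  have hd : h * G \is d.-homog by rewrite -Eh.
  by rewrite -(dhomog_uniq _ fd' hd) -?Eh // prednK // lt0n msize_poly_eq0.
rewrite msizeM //; move: h0 G0; rewrite -!msize_poly_eq0.
move: (msize h) (msize G) (size (restrict p q h)) (size (restrict p q G)) sG sh le.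
by move=> a b x y; lia.
Qed.

Lemma row_free_pair (K : fieldType) n (p q : 'rV[K]_n) :
  p != 0 -> ~~ (q <= p)%MS -> row_free (col_mx p q).
Proof.
move=> p0 qp; apply: inj_row_free => u; rewrite -[u]hsubmxK mul_row_col.
set a := lsubmx u; set b := rsubmx u; rewrite [a]mx11_scalar [b]mx11_scalar !mul_scalar_mx => E.
have b0 : b 0 0 = 0.
  apply: contraNeq qp => b0; have -> : q = (- (b 0 0)^-1 * a 0 0) *: p.
    apply: (scalerI b0); rewrite scalerA mulrA mulrN divff // mulN1r scaleNr.
    by apply/eqP; rewrite -addr_eq0 addrC E.
  exact: scalemx_sub.
move: E; rewrite b0 scale0r addr0 => /eqP; rewrite scaler_eq0 (negbTE p0) orbF => /eqP ->.
by rewrite !raddf0 row_mx0.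
Qed.

Lemma dhomog1M (K : fieldType) n d (l h : {mpoly K[n]}) :
  l \is 1.-homog -> h \is d.-homog -> l * h \is d.+1.-homog.
Proof. by move=> l1 hd; have := dhomogM l1 hd. Qed.

Section GrowthOnLine.
Variables (K : fieldType) (n m : nat) (I : {mpoly K[n.+1]} -> Prop).
Variables (c : 'M[K]_(m, n.+1)) (p q : 'rV[K]_n.+1).
Hypothesis homI : is_homogeneous_ideal I.
Hypothesis codim2 : (m + 2 = n.+1)%N.
Hypothesis c_free : row_free c.
Hypotheses (cp : c *m p^T = 0) (cq : c *m q^T = 0).
Hypothesis pq_free : row_free (col_mx p q).
Local Notation J := (add_linear_forms I c).

(** Since [f0] does not vanish at [p], its restriction has full degree [d], as
    the theorem on binary growth requires. *)
Lemma restrict_maximal_growth d f0 :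
  I f0 -> f0 \is d.-homog -> f0.@[p 0] != 0 ->
  quotient_dim J d = quotient_dim J d.+1 ->
  exists g : {poly K}, size g = (quotient_dim J d).+1 /\
    forall e, (e == d) || (e == d.+1) ->
      (exists h, [/\ I h, h \is e.-homog & divides (restrict p q h) g]) /\
      forall f, I f -> f \is e.-homog -> divides g (restrict p q f).
Proof.
move=> If0 f0d f0p growth; have [[_ _ IM] _] := homI.
have [lx [ly [lxd lyd rx ry _]]] := dual_forms codim2 c_free cp cq pq_free.
pose V := restricted_piece p q J d; pose W := restricted_piece p q J d.+1.
have pieceP e v := restricted_pieceP cp cq (d := e) v homI.
have dimV := quotient_dim_restricted codim2 c_free cp cq pq_free I d.
have dimW := quotient_dim_restricted codim2 c_free cp cq pq_free I d.+1.
have restrictK e h : h \is e.-homog -> rVpoly (@poly_rV K e.+1 (restrict p q h)) = restrict p q h.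
  by move=> he; rewrite poly_rV_K // size_restrict_dhomog.
have mulW l v : l \is 1.-homog -> v \in V -> poly_rV (restrict p q l * rVpoly v) \in W.
  move=> l1 /pieceP [h [Ih hd] ->]; apply/pieceP.
  exists (l * h); last by rewrite restrictK // rmorphM.
  by split; [apply: IM | apply: dhomog1M].
have [|||||g gV [sg gdV gdW]] := @binary_maximal_growth K d V W (restrict p q f0).
- exact: size_restrict_eq.
- by apply/pieceP; exists f0.
- by move=> v vV; have := mulW ly v lyd vV; rewrite ry mul1r.
- by move=> v vV; have := mulW lx v lxd vV; rewrite rx.
- by apply/eqP; rewrite -(eqn_add2l (quotient_dim J d)) {1}growth addnS dimV dimW.
exists (rVpoly g); split.
  by apply/eqP; rewrite -(eqn_add2r (\dim V)) sg addSn dimV.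
have [h [Ih hd Eg]] := pieceP _ _ gV.
move=> e /orP[] /eqP ->.
  split; last by move=> f If fd; rewrite -(restrictK d) //; apply/gdV/pieceP; exists f.
  by exists h; rewrite Eg restrictK //; split=> //; apply: divides_refl.
split; last by move=> f If fd; rewrite -(restrictK d.+1) //; apply/gdW/pieceP; exists f.
exists (ly * h); split; [exact: IM | exact: dhomog1M |].
by rewrite Eg restrictK // rmorphM /= ry mul1r; apply: divides_refl.
Qed.

End GrowthOnLine.

Lemma size_gcd_restrict (K : fieldType) n (I : {mpoly K[n]} -> Prop) e
    (p q : 'rV[K]_n) (g : {poly K}) (G f h : {mpoly K[n]}) :
  (forall f, I f -> f \is e.-homog -> divides G f) ->
  I f -> f \is e.-homog -> f.@[p 0] != 0 ->
  I h -> h \is e.-homog -> divides (restrict p q h) g -> divides g (restrict p q G) ->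
  msize G = size g.
Proof.
move=> Gd If fe fp Ih he hg gG.
rewrite -(size_restrict_divisor q fe fp (Gd _ If fe)); apply: divides_size => //.
by apply: divides_trans hg; have [u ->] := Gd _ Ih he; exists (restrict p q u); rewrite rmorphM.
Qed.

Theorem corollary6p5 (K : fieldType) (charK : [pchar K] =i pred0)
    (n : nat) (n_ge2 : (2 <= n.+1)%N)
    (I : {mpoly K[n.+1]} -> Prop) (homI : is_homogeneous_ideal I)
    (delta : nat)
    (I_delta_neq0 : exists f, [/\ I f, f \is delta.-homog & f != 0])
    (growth : sectional_matrix I 2 delta = sectional_matrix I 2 delta.+1) :
  exists G : {mpoly K[n.+1]},
    [/\ is_gcd (truncated_ideal I delta) G,
        msize G = (sectional_matrix I 2 delta).+1 &
        is_gcd (truncated_ideal I delta.+1) G].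
Proof.
have [f0 [If0 f0d f00]] := I_delta_neq0.
have [idI _] := homI; have [_ _ IM] := idI.
have codim2 : (n.+1 - 2 + 2 = n.+1)%N by rewrite subnK.
have X0 (i : 'I_n.+1) : ('X_i : {mpoly K[n.+1]}) != 0.
  by rewrite -msize_poly_eq0 msizeX mdeg1.
pose f1 := 'X_ord0 * f0.
have If1 : I f1 by apply: IM.
have f1d : f1 \is delta.+1.-homog by apply: dhomog1M; rewrite // dhomogX /= mdeg1.
have f10 : f1 != 0 by rewrite mulf_neq0.
have [G [fs [GI fsI fs0 Gmax]]] := graded_piece_gcd idI If0 f0d f00.
have [G' [fs' [GI' fsI' fs0' Gmax']]] := graded_piece_gcd idI If1 f1d f10.
have [F1 F10 F1P] := sectional_matrix_generic homI 2 delta.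
have [F2 F20 F2P] := sectional_matrix_generic homI 2 delta.+1.
have [F3 F30 F3P] := row_free_open_id K (leq_subr 2 n.+1).
have [v Fv] := mpoly_nonroot charK (mulf_neq0 (mulf_neq0 F10 F20) F30).
set F := F1 * F2 * F3 in Fv.
have Fc0 : F.@[mxvec (vec_mx v : 'M_(n.+1 - 2, n.+1)) 0] != 0 by rewrite vec_mxK.
have le_codim : (n.+1 - 2 + 2 <= n.+1)%N by rewrite codim2.
have cK0 : (vec_mx v : 'M_(n.+1 - 2, n.+1)) *m (0 : 'rV_n.+1)^T = 0.
  by rewrite trmx0 mulmx0.
(* [p] is chosen off the roots of [f1], hence of [f0]; only then are the
   polynomials [r] and [r'] that [q] has to avoid known *)
have [p [c0 [Fc f1p _ c0p p_notin0]]] := line_step charK le_codim Fc0 f10 cK0.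
have p0 : p != 0 by apply: contraNneq p_notin0 => ->; apply: sub0mx.
have f0p : f0.@[p 0] != 0.
  by apply: contraNneq f1p => f0p; rewrite mevalM f0p mulr0.
have [r r0 rP] := restrict_gcd p fs0 Gmax.
have [r' r0' rP'] := restrict_gcd p fs0' Gmax'.
have [q [c [Fc' rq cp cq qp]]] := line_step charK le_codim Fc (mulf_neq0 r0 r0') c0p.
have [Gq Gq'] : r.@[q 0] != 0 /\ r'.@[q 0] != 0.
  by move: rq; rewrite mevalM mulf_eq0 negb_or => /andP.
have [F1c F2c F3c] : [/\ F1.@[mxvec c 0] != 0, F2.@[mxvec c 0] != 0 & F3.@[mxvec c 0] != 0].
  by move: Fc'; rewrite !mevalM !mulf_eq0 !negb_or -andbA => /and3P.
have c_free := F3P _ F3c.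
have pq_free := row_free_pair p0 qp.
have growth_c : quotient_dim (add_linear_forms I c) delta =
    quotient_dim (add_linear_forms I c) delta.+1.
  by rewrite F1P // F2P.
have [g [sg gP]] := restrict_maximal_growth homI codim2 c_free cp cq pq_free If0 f0d f0p growth_c.
have [[h [Ih hd hg]] gdiv] := gP delta (introT orP (or_introl (eqxx _))).
have [[h' [Ih' hd' hg']] gdiv'] := gP delta.+1 (introT orP (or_intror (eqxx _))).
have gG : divides g (restrict p q G) by apply: rP => // f /fsI [If fd]; apply: gdiv.
have gG' : divides g (restrict p q G') by apply: rP' => // f /fsI' [If fd]; apply: gdiv'.
have sG := size_gcd_restrict GI If0 f0d f0p Ih hd hg gG.
have sG' := size_gcd_restrict GI' If1 f1d f1p Ih' hd' hg' gG'.
pose i1 : 'I_n.+1 := Ordinal n_ge2.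
have i01 : ord0 != i1 by [].
have Gfull h1 : (forall f, I f -> f \is delta.-homog -> divides h1 f) -> divides h1 G.
  by move=> hI; apply: Gmax => f /fsI []; apply: hI.
have Gfull' h1 : (forall f, I f -> f \is delta.+1.-homog -> divides h1 f) -> divides h1 G'.
  by move=> hI; apply: Gmax' => f /fsI' []; apply: hI.
have G'G : divides G' G.
  apply: Gfull => f If fd.
  have G'X i : divides G' ('X_i * f).
    by apply: GI'; [apply: IM | apply: dhomog1M; rewrite // dhomogX /= mdeg1].
  exact: divides_mul_variables i01 (G'X _) (G'X _).
have G0 : G != 0 by apply: contraNneq f00 => G0; have [u ->] := GI _ If0 f0d; rewrite G0 mulr0.
have GG' : divides G G' by apply: divides_msize1; rewrite // sG sG'.
exists G; split.
- exact: is_gcd_truncated i01 idI GI Gfull.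
- by rewrite sG sg F1P.
apply: (is_gcd_truncated i01 idI) => [f If fd | h1 /Gfull' h1G'].
  by apply: divides_trans GG' (GI' _ If fd).
exact: divides_trans h1G' G'G.
Qed.
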